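(* Let $X$ be a complex elliptic curve, $\xi$ a line bundle on $X$ of degree $n>1$, $m\ge1$, and consider the local functions $x_i$ and $y_j/y_i$ ($1\le i,j\le m$) on $B'(\xi,m)=\mathbb{P}\mathcal{V}$ defined in the context. Set $$y'_i:=y_i\cdot\prod_{j\ne i}\theta(x_j-x_i).$$ Then in the variables $(x_i)$, $(y'_j/y'_i)$ the Poisson bracket on $B'(\xi,m)$ is given by $$\{x_i,x_j\}=0,\qquad \Big\{\frac{y'_j}{y'_i},\frac{y'_k}{y'_i}\Big\}=0,\qquad \Big\{\frac{y'_j}{y'_i},x_k\Big\}=(\delta_{jk}-\delta_{ik})\frac{y'_j}{y'_i}.$$
   Context: Fix a trivialization of $\omega_X$ and a uniformization $X=\mathbb{C}/\Lambda$ compatible with it (the fixed differential is $dz$). $\theta$ is the theta function on $\mathbb{C}$ attached to $\Lambda$ with simple zeros exactly at lattice points (in particular at $x=0$); its logarithmic derivative agrees with the Weierstrass zeta function $\zeta(x)$ (up to the usual linear term). $B'(\xi,m)$ is the coarse moduli space of chains $\xi\xrightarrow{\phi}\mathcal{O}_D(D)\xrightarrow{u}\mathcal{O}_X[1]$ with $D$ an effective divisor of degree $m$, $\phi\ne0$, and $u$ the class of $0\to\mathcal{O}_X\to\mathcal{O}_X(D)\to\mathcal{O}_D(D)\to0$. It is the projectivization $\mathbb{P}\mathcal{V}$ of the vector bundle $\mathcal{V}$ over $X^{(m)}$ with fiber $H^0(\xi^{-1}(D)|_D)\ni\phi$ at $D$. Local coordinates: fix an open $U_0\subset X$ and a nonvanishing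 section $s_0$ of $\xi|_{U_0}$. On the \'etale open of $\mathrm{tot}(\mathcal{V})$ given by a choice of distinct ordered points $p_1,\dots,p_m\in U_0$ with $D=p_1+\dots+p_m$, let $x_i$ be the projection to $p_i$ (viewed via the uniformization as a local coordinate), and $y_i=\mathrm{Res}_{p_i}(\phi s_0)$, the residue being taken with respect to the fixed differential. One works where all $y_i\neq0$; $x_i$ and $y_j/y_i$ descend to local functions on $\mathbb{P}\mathcal{V}$. Poisson structure on $B'(\xi,m)$: it is induced from the $0$-shifted Poisson structure on the stack of chains $V_0\xrightarrow{d}V_1\xrightarrow{d}V_2$ with $V_0=\xi$, $V_1=\mathcal{O}_D(D)$, $V_2=\mathcal{O}_X[1]$, where $V_0,V_2$ are held fixed. With $E_{ij}=R\underline{\mathrm{Hom}}(V_i,V_j)$, the tangent space is the kernel of $H^1(\mathrm{Cone}[E_{00}\oplus E_{11}\oplus E_{22}\to E_{01}\oplus E_{12}][-1])\to H^1(E_{00}\oplus E_{22})$, with differential $(a_{00},a_{11},a_{22})\mapsto(da_{00}-a_{11}d,da_{11}-a_{22}d)$, and the cotangent space is the cokernel of $H^0(E_{00}\oplus E_{22})\to H^1(\mathrm{Cone}[E_{10}\oplus E_{21}\to E_{00}\oplus E_{11}\oplus E_{22}][-1])$, with differential $(a_{10},a_{21})\mapsto(-a_{10}d,da_{10}-a_{21}d,da_{21})$. The bivector is induced by the chain map $(a_{10},a_{21})\mapsto(a_{10}d,da_{10},da_{21})$, $(b_{00},b_{11},b_{22})\mapsto(0,db_{11})$. Equivalently, at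 a point $(D,\phi)$ with $\phi$ inducing an isomorphism $\mathcal{O}_D\simeq\xi^{-1}(D)|_D$: let $\tau_D:H^0(\mathcal{O}_D(D))\to\mathbb{C}$ be the residue functional, $H_D=\ker\tau_D\simeq H^0(\mathcal{O}(D))/\mathbb{C}$, $F_D:H_D\to H^0(\mathcal{O}(D)|_{2D})/\mathbb{C}$ the restriction map, and $\rho_\phi:H^0(\xi|_{2D})\to H^0(\xi|_D)\xrightarrow{\phi}H^0(\mathcal{O}_D(D))$. The cotangent space is $\rho_\phi^{-1}(H_D)\subset H^0(\xi|_{2D})$ and the bracket is $\langle x,x'\rangle=\tau_D([-F_D(\rho_\phi(x))x'+F_D(\rho_\phi(x'))x]\cdot\phi)$. Under this identification (inside $T^*_{(D,\phi)}\mathrm{tot}(\mathcal{V})\simeq H^0(\xi|_{2D})$) one has $dx_i=\phi^{-1}|_{p_i}\in H^0(\xi(-p_i)|_{p_i})$ and $dy_i=s_0|_{2p_i}$.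
   Formalization: The sign convention is {f,g} = ⟨dg,df⟩ for the explicit pairing ⟨x,x'⟩ of the context; with {f,g} = ⟨df,dg⟩ that pairing gives {y'_j/y'_i, x_k} the opposite sign to the displayed formula, while the two vanishing brackets hold either way. *)

(* Defs.v *)
From HB Require Import structures.
From mathcomp Require Import all_boot all_order all_algebra.
From mathcomp Require Import complex.
From mathcomp Require Import all_classical all_reals all_analysis.

Set Implicit Arguments.
Unset Strict Implicit.
Unset Printing Implicit Defensive.

Import Order.TTheory GRing.Theory Num.Theory.
Import numFieldNormedType.Exports.

Local Open Scope classical_set_scope.
Local Open Scope ring_scope.

(* R[i], packaged so that the topology and norm that MathComp-Analysis puts on
   every numFieldType are found. *)
Definition CC (R : realType) : numClosedFieldType := R[i].

Section HolomorphicFunctions.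
Variable R : realType.
Local Notation C := (CC R).

(* f is holomorphic at z: it is the sum of a convergent power series on a disc
   around z.  (0 < r in C forces r to be real.) *)
Definition holomorphic_at (f : C -> C) (z : C) : Prop :=
  exists (a : nat -> C) (r : C), 0 < r /\
    forall h : C, `|h| < r ->
      series (fun k : nat => a k * h ^+ k) @ \oo --> f (z + h).

Definition holomorphic_on (U : set C) (f : C -> C) : Prop :=
  forall z, U z -> holomorphic_at f z.

Definition entire (f : C -> C) : Prop := forall z, holomorphic_at f z.

Definition expC (z : C) : C :=
  let a := complex.Re (z : R[i]) in
  let b := complex.Im (z : R[i]) in
  ((expR a * cos b) +i* (expR a * sin b))%C.

End HolomorphicFunctions.

(* The elliptic curve is X = C / L with differential dz.  Points of X are
   represented by lifts to C, functions on X by L-periodic functions on C, and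
   opens of X by L-stable opens of C. *)
Section EllipticCurve.
Variable R : realType.
Local Notation C := (CC R).
Implicit Types L U : set C.

Definition is_lattice L : Prop :=
  exists w1 w2 : C, 'Im (w2 / w1) != 0 /\
    L = [set z | exists a b : int, z = a%:~R * w1 + b%:~R * w2].

Definition stable_open L U : Prop :=
  open U /\ forall z l, L l -> U z -> U (z + l).

(* The x i represent pairwise distinct points of X. *)
Definition distinct_mod L (m : nat) (x : 'I_m -> C) : Prop :=
  forall i j, L (x i - x j) -> i = j.

(* The last clause makes the zeros, which are the points of L, simple. *)
Definition is_theta L (theta : C -> C) : Prop :=
  [/\ entire theta,
      forall l, L l -> exists a b : C, forall z,
        theta (z + l) = expC (a * z + b) * theta z,
      forall z, theta z = 0 <-> L z
    & forall z, L z -> derive1 theta z != 0].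

(* A line bundle on X is given by a factor of automorphy e on its trivial
   pullback to C: its sections satisfy s (z + l) = e l z * s z. *)
Definition is_automorphy L (e : C -> C -> C) : Prop :=
  (forall l, L l -> entire (e l) /\ forall z, e l z != 0) /\
  (forall l l', L l -> L l' -> forall z,
     e (l + l') z = e l (z + l') * e l' z).

(* deg xi is the degree of the divisor of a nonzero meromorphic section s:
   ord is the order function of s, and the q i represent, once each, a finite
   set of points of X off which ord vanishes. *)
Definition has_degree L (e : C -> C -> C) (n : int) : Prop :=
  exists (s : C -> C) (ord : C -> int) (k : nat) (q : 'I_k -> C),
  [/\ forall l z, L l -> s (z + l) = e l z * s z,
      forall a, exists g : C -> C, [/\ holomorphic_at g a, g a != 0
        & \forall z \near a^', s z = g z * (z - a) ^ ord a],
      distinct_mod L q,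
      forall a, ord a != 0 -> exists i, L (a - q i)
    & \sum_(i < k) ord (q i) = n].

(* s0 is a nonvanishing section of xi on the open of X defined by U. *)
Definition nonvanishing_section L (e : C -> C -> C) U (s0 : C -> C) : Prop :=
  [/\ holomorphic_on U s0,
      forall l z, L l -> U z -> s0 (z + l) = e l z * s0 z
    & forall z, U z -> s0 z != 0].

End EllipticCurve.

(* D = p_1 + ... + p_m is a sum of distinct points, with lifts x i.  Put
   t = z - x i near x i, and use the trivialization of the pullback of xi to C.

   - A section over 2D of xi is a matrix u : 'M_(m, 2), standing for
     u i 0 + u i 1 * t at p_i (mod t^2); a section over 2D of O(D) or of xi(D)
     is a matrix F, standing for (F i 0 + F i 1 * t) / t at p_i (mod t).
   - A section h of O_D(D) is the family of its residues: h i / t at p_i.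
   - phi in H^0(xi^-1(D)|_D) is the family of its polar coefficients, so that it
     is phi i / t at p_i. *)
Section Bracket.
Variables (R : realType) (m : nat).
Local Notation C := (CC R).
Implicit Types (L : set C) (x y h phi : 'I_m -> C).

Definition tau h : C := \sum_i h i.

(* F is the restriction to 2D of some f in H^0(X, O(D)). *)
Definition restr_2D L x (F : 'M[C]_(m, 2)) : Prop :=
  exists f : C -> C,
  [/\ forall l z, L l -> f (z + l) = f z,
      forall z, (forall i, ~ L (z - x i)) -> holomorphic_at f z
    & forall i, exists g : C -> C,
        [/\ holomorphic_at g (x i),
            \forall z \near (x i)^', f z = g z / (z - x i),
            g (x i) = F i 0
          & derive1 g (x i) = F i 1]].

(* F_D h is only defined modulo constants, for h in ker tau: this is a chosen
   representative (and 0 when h has no lift to H^0(X, O(D))). *)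
Definition F_D L x h : 'M[C]_(m, 2) :=
  xget 0 [set F | restr_2D L x F /\ forall i, F i 0 = h i].

Definition rho phi (u : 'M[C]_(m, 2)) : 'I_m -> C := fun i => u i 0 * phi i.

(* Product of truncated series, modulo t^2. *)
Definition jmul (a b : 'M[C]_(m, 2)) : 'M[C]_(m, 2) :=
  \matrix_(i, k) (if k == 0 then a i 0 * b i 0
                  else a i 0 * b i 1 + a i 1 * b i 0).

(* tau_D ([- F_D(rho u) u' + F_D(rho u') u] . phi).  The expression N in
   brackets stands for (N i 0 + N i 1 * t) / t in xi(D)|_{2D}; as N i 0 = 0 it
   lies in xi|_D, with value N i 1 at p_i. *)
Definition cotangent_bracket L x phi (u u' : 'M[C]_(m, 2)) : C :=
  let N := - jmul (F_D L x (rho phi u)) u' + jmul (F_D L x (rho phi u')) u in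
  tau (fun i => N i 1 * phi i).

(* The point of tot(V) with coordinates (x, y): y i = Res_{p_i}(phi s0). *)
Definition phi_of (s0 : C -> C) x y : 'I_m -> C := fun i => y i / s0 (x i).

(* phi^-1 |_{p_i}, in xi(-p_i)|_{p_i}. *)
Definition dx (s0 : C -> C) x y (i : 'I_m) : 'M[C]_(m, 2) :=
  (phi_of s0 x y i)^-1 *: delta_mx i 1.

(* s0 |_{2 p_i}. *)
Definition dy (s0 : C -> C) x (i : 'I_m) : 'M[C]_(m, 2) :=
  s0 (x i) *: delta_mx i 0 + derive1 s0 (x i) *: delta_mx i 1.

(* The differential of f(x_1..x_m, y_1..y_m), inside H^0(xi|_{2D}). *)
Definition differential (s0 : C -> C)
    (f : ('I_m -> C) -> ('I_m -> C) -> C) x y :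
    'M[C]_(m, 2) :=
  \sum_i derive1 (fun t : C => f (dfwith x i t) y) (x i) *: dx s0 x y i
  + \sum_i derive1 (fun t : C => f x (dfwith y i t)) (y i) *: dy s0 x i.

(* Sign convention: {f, g} is <dg, df>, i.e. dg evaluated on the Hamiltonian
   vector field Pi(df), with <u, u'> = <u, Pi(u')>.  The opposite convention
   replaces every bracket by its negative.
   Local functions on P(V) are functions f(x, y) homogeneous of degree 0 in y. *)
Definition poisson_bracket L (s0 : C -> C)
    (f g : ('I_m -> C) -> ('I_m -> C) -> C) x y : C :=
  cotangent_bracket L x (phi_of s0 x y) (differential s0 g x y) (differential s0 f x y).

(* Points of the chart of tot(V) over U where no y i vanishes. *)
Definition in_chart L (U : set C) x y : Prop :=
  [/\ forall i, U (x i), distinct_mod L x & forall i, y i != 0].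

Definition x_coord (i : 'I_m) : ('I_m -> C) -> ('I_m -> C) -> C :=
  fun x _ => x i.

Definition y' (theta : C -> C) (i : 'I_m) : ('I_m -> C) -> ('I_m -> C) -> C :=
  fun x y => y i * \prod_(j < m | j != i) theta (x j - x i).

(* y'_j / y'_i. *)
Definition y'_ratio (theta : C -> C) (j i : 'I_m) :
    ('I_m -> C) -> ('I_m -> C) -> C :=
  fun x y => y' theta j x y / y' theta i x y.

End Bracket.

(* Main.v *)
Require Import Defs.
From HB Require Import structures.
From mathcomp Require Import all_boot all_order all_algebra.
From mathcomp Require Import complex.
From mathcomp Require Import all_classical all_reals all_analysis.
From mathcomp Require Import ring lra.
Import Order.TTheory GRing.Theory Num.Theory.
Import numFieldNormedType.Exports.
Local Open Scope classical_set_scope.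
Local Open Scope ring_scope.

(** Write Z for theta' / theta.  As theta is quasi-periodic with multiplier
    exp (a z + b), Z changes by an additive constant under translation by a
    lattice vector, and it has simple poles of residue 1 at the lattice.  So if
    sum_i b_i = 0, then z |-> sum_a b_a Z (z - x_a) is an L-periodic function
    with residues b_a at x_a.  Two such functions differ by a periodic entire
    function, that is by a constant, and therefore F_D b has the polar part b
    and the linear part W b + c, where c is a constant and
    W l a = Z (x_l - x_a) for l <> a, W l l being the constant term of Z at 0
    ([F_D_spec]).

    Describe a covector by its coefficients a_l on dx_l and b_l on
    d(log y_l) = dy_l / y_l.  It lies in the cotangent space of P(V) when
    sum_l b_l = 0, and the bracket of two such covectors is
      sum_l (b'_l a_l - b_l a'_l + (W b')_l b_l - (W b)_l b'_l)
    ([cotangent_bracketE]): the section s0 cancels, and the constants c drop out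
    because the weights sum to zero.

    For the coordinate x_k the weights are b = 0, and a is the k-th unit vector;
    this gives the first and the third bracket at once.  For y'_j / y'_i, with
    b = (y'_j / y'_i) (e_j - e_i), differentiating log theta (x_k - x_i) shows
    that a_l = (W b)_l - S_l b_l with S_l = sum_k W k l
    ([differential_y'_ratio]): the theta factors in y' are there to make
    the x-part of the differential equal to W b up to a diagonal term.  With
    this a, each summand of the bracket of two ratios vanishes separately: the
    two occurrences of W cancel, and the S_l part is symmetric in b and b'.

    The analysis behind it is elementary.  Holomorphic germs are handled through
    power series whose coefficients are bounded by M q^k, which is stable under
    products and inverses; a power series satisfies the local maximum principle
    because its first non-constant term can be aligned with its constant term;
    and compactness of a fundamental parallelogram then shows that a periodic
    entire function attains its maximum, hence is constant
    ([periodic_entire_cst]). *)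

Set Implicit Arguments.
Unset Strict Implicit.
Unset Printing Implicit Defensive.

(** * Real-valued modulus and limits in C *)

Section Modulus.
Variable R : realType.
Local Notation C := (CC R).

(** The norm of C takes its values in C; its real part is more convenient, as
    the order of R is total. *)
Definition modulus (z : C) : R := complex.Re (`|z| : R[i]).

Definition ofR (r : R) : C := (r%:C)%C.

Lemma modulusE (z : C) : `|z| = ofR (modulus z).
Proof. by rewrite /ofR /modulus normc_def. Qed.

Lemma ofR_le (a b : R) : (ofR a <= ofR b) = (a <= b).
Proof. by rewrite /ofR lecR. Qed.
Lemma ofR_lt (a b : R) : (ofR a < ofR b) = (a < b).
Proof. by rewrite /ofR ltcR. Qed.

Lemma ofRM a b : ofR (a * b) = ofR a * ofR b.
Proof. exact: rmorphM. Qed.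
Lemma ofRD a b : ofR (a + b) = ofR a + ofR b.
Proof. exact: rmorphD. Qed.
Lemma ofRB a b : ofR (a - b) = ofR a - ofR b.
Proof. exact: rmorphB. Qed.
Lemma ofRX a n : ofR (a ^+ n) = ofR a ^+ n.
Proof. exact: rmorphXn. Qed.
Lemma ofR_inj : injective ofR.
Proof. by move=> a b [->]. Qed.

Lemma modulus_ge0 z : 0 <= modulus z.
Proof. by rewrite -ofR_le -modulusE normr_ge0. Qed.
Lemma modulusM z w : modulus (z * w) = modulus z * modulus w.
Proof. by apply: ofR_inj; rewrite ofRM -!modulusE normrM. Qed.
Lemma modulusX z n : modulus (z ^+ n) = modulus z ^+ n.
Proof. by apply: ofR_inj; rewrite ofRX -!modulusE normrX. Qed.
Lemma modulusD z w : modulus (z + w) <= modulus z + modulus w.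
Proof. by rewrite -ofR_le ofRD -!modulusE ler_normD. Qed.
Lemma modulusN z : modulus (- z) = modulus z.
Proof. by rewrite /modulus normrN. Qed.
Lemma modulusB z w : modulus (z - w) <= modulus z + modulus w.
Proof. by rewrite (le_trans (modulusD _ _)) // modulusN. Qed.
Lemma modulusC z w : modulus (z - w) = modulus (w - z).
Proof. by rewrite -modulusN opprB. Qed.
Lemma modulus0 : modulus 0 = 0.
Proof. by rewrite /modulus normr0. Qed.
Lemma modulus1 : modulus 1 = 1.
Proof. by rewrite /modulus normr1. Qed.
Lemma modulus_eq0 z : (modulus z == 0) = (z == 0).
Proof. by rewrite -(inj_eq ofR_inj) -modulusE normr_eq0. Qed.
Lemma modulus_gt0 z : (0 < modulus z) = (z != 0).
Proof. by rewrite lt_neqAle modulus_ge0 andbT eq_sym modulus_eq0. Qed.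
Lemma modulusV z : modulus z^-1 = (modulus z)^-1.
Proof. by apply: ofR_inj; rewrite -modulusE normfV modulusE -fmorphV. Qed.
Lemma modulus_ofR r : modulus (ofR r) = `|r|.
Proof.
by apply: ofR_inj; rewrite -modulusE /ofR normc_def /= expr0n /= addr0 sqrtr_sqr.
Qed.
Lemma modulus_nat n : modulus n%:R = n%:R.
Proof. by apply: ofR_inj; rewrite -modulusE normr_nat /ofR rmorph_nat. Qed.
Lemma modulus_sum (I : Type) (s : seq I) (P : pred I) (F : I -> C) :
  modulus (\sum_(i <- s | P i) F i) <= \sum_(i <- s | P i) modulus (F i).
Proof.
elim/big_ind2 : _ => [|a b c d ab cd|//]; first by rewrite modulus0.
by rewrite (le_trans (modulusD _ _)) // lerD.
Qed.

Lemma modulus_small_eq (z w : C) :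
  (forall e : R, 0 < e -> modulus (z - w) <= e) -> z = w.
Proof.
move=> h; apply/eqP; rewrite -subr_eq0 -modulus_eq0 eq_le modulus_ge0 andbT.
by apply/ler_addgt0Pl => e e0; rewrite addr0 h.
Qed.

Lemma pos_ofR (r : C) : 0 < r -> exists2 e : R, 0 < e & r = ofR e.
Proof.
move=> r0; exists (modulus r); first by rewrite modulus_gt0 gt_eqF.
by rewrite -modulusE gtr0_norm.
Qed.

Lemma cvg_modulusP (u : nat -> C) (l : C) :
  u @ \oo --> l <->
  forall e : R, 0 < e -> exists N, forall n, (N <= n)%N -> modulus (u n - l) < e.
Proof.
split.
- move=> /cvgrPdist_lt ul e e0.
  have [|N _ H] := ul (ofR e); first by rewrite -[0]/(ofR 0) ofR_lt.
  exists N => n Nn; rewrite modulusC -ofR_lt -modulusE; exact: H.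
- move=> H; apply/cvgrPdist_lt => e /pos_ofR[d d0 ->].
  have [N HN] := H _ d0; exists N => // n /= Nn.
  by rewrite modulusE ofR_lt modulusC; exact: HN.
Qed.

Lemma nbhs_modulusP (z : C) (P : C -> Prop) :
  (\forall w \near z, P w) <->
  exists2 d : R, 0 < d & forall w, modulus (w - z) < d -> P w.
Proof.
split.
- move=> /nbhs_ballP[r /= /pos_ofR[d d0 ->]] H; exists d => // w wd.
  by apply: H; rewrite /ball /= modulusC in wd *; rewrite modulusE ofR_lt.
- move=> [d d0 H]; change (nbhs z P); apply/nbhs_ballP.
  exists (ofR d) => /=; first by rewrite -[0]/(ofR 0) ofR_lt.
  by move=> w /=; rewrite /ball /= modulusE ofR_lt modulusC => /H.
Qed.

Lemma continuous_modulusP (f : C -> C) (z : C) :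
  {for z, continuous f} <->
  forall e : R, 0 < e -> exists2 d : R, 0 < d &
    forall w, modulus (w - z) < d -> modulus (f w - f z) < e.
Proof.
split.
- move=> fz e e0.
  have : \forall w \near z, modulus (f w - f z) < e.
    apply: (fz [set w | modulus (w - f z) < e]).
    by apply/nbhs_modulusP; exists e.
  by move=> /nbhs_modulusP.
- move=> H P /nbhs_modulusP[e e0 He]; have [d d0 Hd] := H _ e0.
  by apply/nbhs_modulusP; exists d => // w /Hd /He.
Qed.

End Modulus.

(** * Power series with geometrically bounded coefficients *)

Section PowerSeries.
Variable R : realType.
Local Notation C := (CC R).
Implicit Types (a b : nat -> C) (f g : C -> C) (z h : C) (q t : R).

Definition psum a h n : C := \sum_(k < n) a k * h ^+ k.

(** The coefficients of a convergent power series are at most M q^k.  On the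
    disc q |h| <= 1/4 its k-th term is at most M / 4^k, which leaves room to
    absorb a factor k <= 2^k. *)
Definition expansion f z a (M q : R) : Prop :=
  [/\ 0 < q, 0 <= M, forall k, modulus (a k) <= M * q ^+ k
    & forall h, q * modulus h <= 4^-1 -> psum a h @ \oo --> f (z + h)].

(** The terms of a series that converges at h0 are bounded, by M say, and
    q = 1 / |h0| works. *)
Lemma holomorphic_expansion f z :
  holomorphic_at f z -> exists a M q, expansion f z a M q.
Proof.
move=> [a [_ [/pos_ofR[r r0 ->] fa]]].
have r20 : 0 < r / 2 by lra.
pose h0 : C := ofR (r / 2).
have h0r : modulus h0 = r / 2 by rewrite modulus_ofR ger0_norm // ltW.
have : series (fun k => a k * h0 ^+ k) @ \oo --> f (z + h0).
  by apply: fa; rewrite modulusE ofR_lt h0r; lra.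
move=> cv; have /cvg_series_cvg_0/cvg_modulusP : cvgn (series (fun k => a k * h0 ^+ k)).
  by apply/cvg_ex; exists (f (z + h0)).
move=> /(_ 1 ltr01)[N HN].
pose M : R := 1 + \sum_(k < N) modulus (a k * h0 ^+ k).
have M0 : 0 <= \sum_(k < N) modulus (a k * h0 ^+ k).
  by apply: sumr_ge0 => k _; exact: modulus_ge0.
have bd k : modulus (a k * h0 ^+ k) <= M.
  have [kN|Nk] := ltnP k N.
    rewrite /M (bigD1 (Ordinal kN)) //= addrCA lerDl.
    by rewrite addr_ge0 // sumr_ge0 // => i _; exact: modulus_ge0.
  by have := HN _ Nk; rewrite subr0 => /ltW /le_trans; apply; rewrite /M lerDl.
exists a, M, (r / 2)^-1; split.
- by rewrite invr_gt0.
- by rewrite /M; lra.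
- move=> k; have := bd k; rewrite modulusM modulusX h0r exprVn => H.
  by rewrite ler_pdivlMr // exprn_gt0.
- move=> h hr.
  rewrite (_ : psum a h = series (fun k => a k * h ^+ k)).
    apply: fa; rewrite modulusE ofR_lt.
    by move: hr; rewrite mulrC ler_pdivrMr //; lra.
  by apply/funext => n; rewrite /psum /series /= big_mkord.
Qed.

Lemma expansion_holomorphic f z a M q : expansion f z a M q -> holomorphic_at f z.
Proof.
move=> [q0 M0 _ H]; exists a, (ofR ((4 * q)^-1)); split.
  by rewrite -[0]/(ofR 0) ofR_lt invr_gt0; lra.
move=> h; rewrite modulusE ofR_lt => hr.
rewrite (_ : series _ = psum a h); last first.
  by apply/funext => n; rewrite /psum /series /= big_mkord.
apply: H; move: hr; rewrite -div1r ltr_pdivlMr; lra.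
Qed.

Lemma expansion_weaken f z a M q M' q' :
  M <= M' -> q <= q' -> expansion f z a M q -> expansion f z a M' q'.
Proof.
move=> MM qq [q0 M0 ak H]; split; [lra|lra| |].
- move=> k; rewrite (le_trans (ak k)) // ler_pM // ?exprn_ge0 ?(ltW q0) //.
  by rewrite lerXn2r // nnegrE; lra.
- move=> h hq; apply: H; rewrite (le_trans _ hq) // ler_wpM2r //.
  exact: modulus_ge0.
Qed.

Lemma psumS a h n : psum a h n.+1 = psum a h n + a n * h ^+ n.
Proof. by rewrite /psum big_ord_recr. Qed.

Lemma psum0 a h : psum a h 0 = 0.
Proof. by rewrite /psum big_ord0. Qed.

(** The difference telescopes: with t = q |h| <= 1/2 it stays below
    2 M (t^j - t^N), a form that is preserved by adding one more term. *)
Lemma psum_tail a (M q : R) h j N :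
  0 < q -> 0 <= M -> (forall k, modulus (a k) <= M * q ^+ k) ->
  q * modulus h <= 2^-1 -> (j <= N)%N ->
  modulus (psum a h N - psum a h j) <= 2 * M * (q * modulus h) ^+ j.
Proof.
move=> q0 M0 ak hq jN; set t := q * modulus h in hq *.
have t0 : 0 <= t by rewrite mulr_ge0 ?modulus_ge0 ?ltW.
suff: modulus (psum a h N - psum a h j) <= 2 * M * (t ^+ j - t ^+ N).
  move=> /le_trans; apply; rewrite ler_wpM2l //; first lra.
  by rewrite lerBlDr lerDl exprn_ge0.
rewrite -(subnKC jN); elim: (N - j)%N => [|d IH].
  by rewrite addn0 !subrr modulus0 mulr0.
rewrite addnS psumS addrAC (le_trans (modulusD _ _)) //.
have tn : 0 <= t ^+ (j + d) by rewrite exprn_ge0.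
have : modulus (a (j + d)%N * h ^+ (j + d)) <= M * t ^+ (j + d).
  rewrite modulusM modulusX /t exprMn mulrA ler_wpM2r //.
  by rewrite exprn_ge0 // modulus_ge0.
have : M * t ^+ (j + d) * t <= M * t ^+ (j + d) * 2^-1.
  by rewrite ler_wpM2l // mulr_ge0.
rewrite exprS; lra.
Qed.

Lemma cvg_modulus_le (u : nat -> C) (l c : C) (B : R) :
  u @ \oo --> l -> (exists N, forall n, (N <= n)%N -> modulus (u n - c) <= B) ->
  modulus (l - c) <= B.
Proof.
move=> /cvg_modulusP ul [N HN]; apply/ler_addgt0Pl => e /ul[N' HN'].
have H1 := HN (maxn N N') (leq_maxl _ _).
have H2 := HN' (maxn N N') (leq_maxr _ _).
rewrite (_ : l - c = (u (maxn N N') - c) - (u (maxn N N') - l)); last by ring.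
by have := modulusB (u (maxn N N') - c) (u (maxn N N') - l); lra.
Qed.

Lemma expansion_tail f z a M q h j : expansion f z a M q ->
  q * modulus h <= 4^-1 ->
  modulus (f (z + h) - psum a h j) <= 2 * M * (q * modulus h) ^+ j.
Proof.
move=> [q0 M0 ak H] hq; apply: (cvg_modulus_le (H _ hq)).
by exists j => n jn; apply: psum_tail => //; lra.
Qed.

Lemma expansion_at f z a M q : expansion f z a M q -> f z = a 0.
Proof.
move=> E; apply: modulus_small_eq => e e0.
have := @expansion_tail _ _ _ _ _ 0 1%N E.
rewrite modulus0 mulr0 expr1 mulr0 addr0 psumS psum0 add0r expr0 mulr1.
by move=> H; rewrite (le_trans (H _)) ?invr_ge0 // ltW.
Qed.

Lemma expansion_continuous f z a M q : expansion f z a M q -> {for z, continuous f}.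
Proof.
move=> E; apply/continuous_modulusP => e e0.
have [q0 M0 _ _] := E.
pose c := 2 * M * q / e.
have c0 : 0 <= c by apply: divr_ge0 (ltW e0); apply: mulr_ge0 (ltW q0); lra.
have ce : c * e = 2 * M * q by rewrite divfK // gt_eqF.
exists (4 * q + c)^-1; first by rewrite invr_gt0; lra.
move=> w; rewrite -div1r ltr_pdivlMr; last lra.
move=> wd; have mw := modulus_ge0 (w - z).
have X0 : 0 <= modulus (w - z) * c by rewrite mulr_ge0.
have Y0 : 0 <= modulus (w - z) * q by rewrite mulr_ge0 // ltW.
have := @expansion_tail _ _ _ _ _ (w - z) 1%N E.
rewrite psumS psum0 add0r expr0 mulr1 expr1 -(expansion_at E) [z + _]addrC subrK.
move=> H; apply: le_lt_trans (H _) _; first by lra.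
have X1 : modulus (w - z) * c < 1 by lra.
have : modulus (w - z) * c * e < e by rewrite -[ltRHS]mul1r ltr_pM2r.
by rewrite -mulrA ce; lra.
Qed.

(** Dropping the constant coefficient of the series of f and shifting gives
    the series of the difference quotient of f at z. *)
Lemma expansion_div f z a M q : expansion f z a M q ->
  exists g, expansion g z (fun k => a k.+1) (M * q) q /\
            forall w, f w = a 0 + (w - z) * g w.
Proof.
move=> E; have [q0 M0 ak H] := E.
exists (fun w => if w == z then a 1%N else (f w - a 0) / (w - z)); split; last first.
  move=> w; case: eqP => [->|/eqP wz]; first by rewrite subrr mul0r addr0 (expansion_at E).
  by rewrite mulrC divfK ?subr_eq0 // addrC subrK.
have shift h n : psum a h n.+1 = a 0 + h * psum (fun k => a k.+1) h n.
  rewrite /psum big_ord_recl expr0 mulr1; congr (_ + _).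
  by rewrite big_distrr /=; apply: eq_bigr => i _; rewrite /bump /= exprS mulrCA.
split.
- exact: q0.
- exact: mulr_ge0 (ltW q0).
- by move=> k; rewrite -mulrA -exprS.
move=> h hq; have -> : (z + h == z) = (h == 0) by rewrite -subr_eq0 addrAC subrr add0r.
case: eqP => [->|/eqP h0].
  apply/cvg_modulusP => e e0; exists 1%N => -[//|n] _.
  rewrite /psum big_ord_recl expr0 mulr1 big1 ?addr0 ?subrr ?modulus0 // => i _.
  by rewrite exprS mul0r mulr0.
rewrite (_ : psum _ h = fun n => (psum a h n.+1 - a 0) * h^-1); last first.
  by apply/funext => n; rewrite shift addrAC subrr add0r mulrC mulKf.
rewrite (_ : z + h - z = h); last by ring.
apply: cvgMr_tmp; apply: cvgB; last exact: cvg_cst.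
by move: (H _ hq); rewrite -cvg_shiftS.
Qed.

Lemma expansion_divX f z a M q k : expansion f z a M q ->
  exists g, holomorphic_at g z /\ g z = a k /\
    forall w, f w = \sum_(i < k) a i * (w - z) ^+ i + (w - z) ^+ k * g w.
Proof.
elim: k f a M => [|k IH] f a M E.
  exists f; split; first exact: expansion_holomorphic E.
  by split => [|w]; [exact: expansion_at E | rewrite big_ord0 add0r mul1r].
have [g [Eg fg]] := expansion_div E; have [g' [g'h [g'z gg']]] := IH _ _ _ Eg.
exists g'; split => //; split=> // w.
rewrite fg gg' big_ord_recl expr0 mulr1 mulrDr -addrA; congr (_ + _).
rewrite exprS -mulrA; congr (_ + _).
by rewrite big_distrr /=; apply: eq_bigr => i _; rewrite /bump /= exprS mulrCA.
Qed.

End PowerSeries.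

(** * Algebra of holomorphic germs *)

Section Products.
Variable R : realType.
Local Notation C := (CC R).
Implicit Types (a b : nat -> C) (f g : C -> C) (z h : C) (q t : R).

Lemma holomorphic_cst (c z : C) : holomorphic_at (fun=> c) z.
Proof.
apply: (@expansion_holomorphic _ _ _ (fun k => if k is 0%N then c else 0) (modulus c) 1).
split; [exact: ltr01|exact: modulus_ge0| |].
  by case=> [|k]; rewrite expr1n mulr1 ?modulus0 // modulus_ge0.
move=> h _; apply/cvg_modulusP => e e0; exists 1%N => -[//|n] _.
rewrite /psum big_ord_recl expr0 mulr1 big1 ?addr0 ?subrr ?modulus0 // => i _.
by rewrite mul0r.
Qed.

Lemma holomorphic_shift f (z w : C) :
  holomorphic_at f (z - w) -> holomorphic_at (fun u => f (u - w)) z.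
Proof.
move=> [a [r [r0 H]]]; exists a, r; split; first exact: r0.
by move=> h hr; rewrite addrAC; exact: H.
Qed.

Lemma holomorphic_id z : holomorphic_at (fun w : C => w) z.
Proof.
apply: (@expansion_holomorphic _ _ _ 
  (fun k => if k is 0%N then z else if k is 1%N then 1 else 0) (modulus z + 1) 1).
have z0 := modulus_ge0 z.
split; [exact: ltr01| lra | |].
  by case=> [|[|k]]; rewrite expr1n mulr1 ?modulus0 ?modulus1; lra.
move=> h _; apply/cvg_modulusP => e e0; exists 2%N => -[//|[//|n]] _.
rewrite /psum !big_ord_recl expr0 mulr1 big1 => [|i _]; last by rewrite mul0r.
by rewrite mul1r expr1 addr0 subrr modulus0.
Qed.

Lemma holomorphicD f g z :
  holomorphic_at f z -> holomorphic_at g z -> holomorphic_at (fun w => f w + g w) z.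
Proof.
move=> /holomorphic_expansion[a [M [q Ef]]] /holomorphic_expansion[b [M' [q' Eg]]].
have [q0 M0 _ _] := Ef; have [q'0 M'0 _ _] := Eg.
have q1 : q <= q + q' by lra.
have q2 : q' <= q + q' by lra.
have [_ _ ak Ha] := expansion_weaken (lexx M) q1 Ef.
have [_ _ bk Hb] := expansion_weaken (lexx M') q2 Eg.
apply: (@expansion_holomorphic _ _ _ (fun k => a k + b k) (M + M') (q + q')).
split; [lra|lra| |].
  move=> k; rewrite mulrDl (le_trans (modulusD _ _)) // lerD //.
move=> h hq; rewrite (_ : psum _ h = fun n => psum a h n + psum b h n).
  by apply: cvgD; [exact: Ha hq|exact: Hb hq].
apply/funext => n; rewrite /psum -big_split /=.
by apply: eq_bigr => i _; rewrite mulrDl.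
Qed.

Definition cauchy_prod a b (n : nat) : C := \sum_(i < n.+1) a i * b (n - i)%N.

(** Regrouping the triangle i + j < n by the power of h coming from a leaves
    complete partial sums of b. *)
Lemma psum_cauchy a b h n :
  psum (cauchy_prod a b) h n = \sum_(i < n) a i * h ^+ i * psum b h (n - i).
Proof.
elim: n => [|n IH]; first by rewrite /psum !big_ord0.
rewrite psumS IH big_ord_recr /= subSnn psumS psum0 add0r expr0 mulr1.
rewrite /cauchy_prod big_ord_recr /= subnn mulrDl addrA; congr (_ + _); last by ring.
rewrite big_distrl -big_split /=; apply: eq_bigr => i _.
rewrite subSn; last exact: ltnW.
rewrite psumS mulrDr; congr (_ + _).
have -> : h ^+ n = h ^+ i * h ^+ (n - i) by rewrite -exprD subnKC // ltnW.
by ring.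
Qed.

(** As n <= 2^n and t <= 1/4, the sequence is dominated by |K| / 2^n. *)
Lemma geometric_small (K t e : R) : 0 <= t -> t <= 4^-1 -> 0 < e ->
  exists N, forall n, (N <= n)%N -> K * n%:R * t ^+ n < e.
Proof.
move=> t0 t4 e0.
have /cvgrPdist_lt/(_ (e / (`|K| + 1))) : (2^-1 : R) ^+ n @[n --> \oo] --> 0.
  by apply: cvg_expr; rewrite ger0_norm; lra.
have K0 := normr_ge0 K; case; first by rewrite divr_gt0 //; lra.
move=> N _ HN; exists N => n Nn; have := HN n Nn.
rewrite sub0r normrN /= ger0_norm; last by apply: exprn_ge0; lra.
rewrite ltr_pdivlMr; last lra.
move=> Hn; have p0 : 0 <= (2^-1 : R) ^+ n by apply: exprn_ge0; lra.
have n2 : n%:R * t ^+ n <= (2^-1 : R) ^+ n.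
  have -> : (2^-1 : R) ^+ n = 2 ^+ n * (4^-1) ^+ n by rewrite -exprMn; congr (_ ^+ _); lra.
  apply: ler_pM => //; first exact: exprn_ge0.
    by rewrite -natrX ler_nat ltnW // ltn_expl.
  by rewrite lerXn2r ?nnegrE; lra.
have nt0 : 0 <= n%:R * t ^+ n by rewrite mulr_ge0 // exprn_ge0.
rewrite -mulrA (le_lt_trans (ler_norm _)) // normrM (ger0_norm nt0).
rewrite (le_lt_trans _ Hn) // mulrC ler_pM //; lra.
Qed.

(** By [psum_cauchy], the error is the sum over i < n of a_i h^i times a tail of
    b of length i; each of these n terms is O(t^n). *)
Lemma cauchy_prod_error a b (M M' q : R) h n :
  0 < q -> 0 <= M -> 0 <= M' ->
  (forall k, modulus (a k) <= M * q ^+ k) -> (forall k, modulus (b k) <= M' * q ^+ k) ->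
  q * modulus h <= 4^-1 ->
  modulus (psum a h n * psum b h n - psum (cauchy_prod a b) h n) <=
  2 * M * M' * n%:R * (q * modulus h) ^+ n.
Proof.
move=> q0 M0 M'0 ak bk hq; rewrite psum_cauchy {1}/psum big_distrl /= -sumrB.
set t := q * modulus h in hq *.
have t0 : 0 <= t by rewrite mulr_ge0 ?modulus_ge0 ?ltW.
rewrite (le_trans (modulus_sum _ _ _)) //.
rewrite (_ : 2 * M * M' * _ * _ = \sum_(i < n) 2 * M * M' * t ^+ n); last first.
  by rewrite sumr_const card_ord -[RHS]mulr_natr; ring.
apply: ler_sum => i _; rewrite -mulrBr modulusM.
have H : modulus (psum b h n - psum b h (n - i)) <= 2 * M' * t ^+ (n - i).
  by apply: psum_tail; [| | |apply: (le_trans hq); lra|exact: leq_subr].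
have -> : 2 * M * M' * t ^+ n = (M * t ^+ i) * (2 * M' * t ^+ (n - i)).
  have -> : t ^+ n = t ^+ i * t ^+ (n - i) by rewrite -exprD subnKC // ltnW.
  by ring.
apply: ler_pM => //; try exact: modulus_ge0.
rewrite modulusM modulusX /t exprMn mulrA ler_wpM2r //.
by rewrite exprn_ge0 // modulus_ge0.
Qed.

(** Convergence of the series of b is not assumed, so that this also applies to
    the formal inverse of a, where it yields the convergence. *)
Lemma cauchy_prod_error_cvg a b (M M' q : R) h :
  0 < q -> 0 <= M -> 0 <= M' ->
  (forall k, modulus (a k) <= M * q ^+ k) -> (forall k, modulus (b k) <= M' * q ^+ k) ->
  q * modulus h <= 4^-1 ->
  (fun n => psum a h n * psum b h n - psum (cauchy_prod a b) h n) @ \oo --> (0 : C).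
Proof.
move=> q0 M0 M'0 ak bk hq; apply/cvg_modulusP => e e0.
have t0 : 0 <= q * modulus h by rewrite mulr_ge0 ?modulus_ge0 ?ltW.
have [N HN] := geometric_small (2 * M * M') t0 hq e0.
exists N => n /HN; rewrite subr0; apply: le_lt_trans.
exact: cauchy_prod_error.
Qed.

Lemma holomorphicM f g z :
  holomorphic_at f z -> holomorphic_at g z -> holomorphic_at (fun w => f w * g w) z.
Proof.
move=> /holomorphic_expansion[a [M [q Ef]]] /holomorphic_expansion[b [M' [q' Eg]]].
have [q0 M0 _ _] := Ef; have [q'0 M'0 _ _] := Eg.
have q1 : q <= q + q' by lra.
have q2 : q' <= q + q' by lra.
have [Q0 _ ak Ha] := expansion_weaken (lexx M) q1 Ef.
have [_ _ bk Hb] := expansion_weaken (lexx M') q2 Eg.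
set Q := q + q' in Q0 ak bk Ha Hb.
apply: (@expansion_holomorphic _ _ _ (cauchy_prod a b) (M * M') (2 * Q)).
split; [lra|exact: mulr_ge0| |].
  move=> k; rewrite (le_trans (modulus_sum _ _ _)) //.
  rewrite (@le_trans _ _ (\sum_(i < k.+1) M * M' * Q ^+ k)) //.
    apply: ler_sum => i _; rewrite modulusM.
    have -> : M * M' * Q ^+ k = (M * Q ^+ i) * (M' * Q ^+ (k - i)).
      have -> : Q ^+ k = Q ^+ i * Q ^+ (k - i).
        by rewrite -exprD subnKC // -ltnS.
      by ring.
    by apply: ler_pM => //; exact: modulus_ge0.
  rewrite sumr_const card_ord -[leLHS]mulr_natr -mulrA ler_wpM2l ?mulr_ge0 //.
  rewrite [leLHS]mulrC.
  rewrite exprMn ler_wpM2r ?exprn_ge0 ?(ltW Q0) //.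
  by rewrite -natrX ler_nat ltn_expl.
move=> h hq; have h0 := modulus_ge0 h.
have Qh : 0 <= Q * modulus h by rewrite mulr_ge0 // ltW.
have hQ : Q * modulus h <= 4^-1 by lra.
have E := cauchy_prod_error_cvg Q0 M0 M'0 ak bk hQ.
rewrite (_ : psum _ h = fun n => psum a h n * psum b h n -
  (psum a h n * psum b h n - psum (cauchy_prod a b) h n)); last first.
  by apply/funext => n; rewrite opprB addrC subrK.
rewrite -[X in _ --> X]subr0; apply: (cvgB _ E); apply: cvgM; [exact: Ha|exact: Hb].
Qed.

(** The first n coefficients of the formal inverse of a; a list is kept since
    each coefficient depends on all the previous ones. *)
Fixpoint inverse_prefix a (n : nat) : seq C :=
  if n is n'.+1 then
    let l := inverse_prefix a n' in
    rcons l (if n' is 0%N then (a 0%N)^-1 else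
             - (a 0%N)^-1 * \sum_(i < n') a i.+1 * nth 0 l (n'.-1 - i))
  else [::].

Definition inverse_coef a (n : nat) : C := nth 0 (inverse_prefix a n.+1) n.

Lemma size_inverse_prefix a n : size (inverse_prefix a n) = n.
Proof. by elim: n => //= n IH; rewrite size_rcons IH. Qed.

Lemma nth_inverse_prefix a n k : (k < n)%N ->
  nth 0 (inverse_prefix a n) k = inverse_coef a k.
Proof.
elim: n => // n IH; rewrite ltnS leq_eqVlt => /orP[/eqP -> //|kn].
by rewrite /= nth_rcons size_inverse_prefix kn IH.
Qed.

Lemma inverse_coef0 a : inverse_coef a 0 = (a 0%N)^-1.
Proof. by []. Qed.

Lemma inverse_coefS a n : inverse_coef a n.+1 =
  - (a 0%N)^-1 * \sum_(i < n.+1) a i.+1 * inverse_coef a (n - i).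
Proof.
have prefixE : inverse_prefix a n.+2 = rcons (inverse_prefix a n.+1)
    (- (a 0%N)^-1 *
      \sum_(i < n.+1) a i.+1 * nth 0 (inverse_prefix a n.+1) (n - i)) by [].
rewrite {1}/inverse_coef prefixE nth_rcons size_inverse_prefix ltnn eqxx.
congr (_ * _); apply: eq_bigr => i _; rewrite nth_inverse_prefix //.
by rewrite ltnS leq_subr.
Qed.

Lemma cauchy_inverse a n : a 0%N != 0 ->
  cauchy_prod a (inverse_coef a) n = (n == 0)%:R.
Proof.
move=> a0; rewrite /cauchy_prod; case: n => [|n].
  by rewrite big_ord1 inverse_coef0 divff.
rewrite big_ord_recl subn0 inverse_coefS mulNr mulrN mulrA divff // mul1r.
by rewrite addrC; apply/eqP; rewrite subr_eq0; apply/eqP/eq_bigr => i _.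
Qed.

(** If |a_k| <= M q^k, the recursion bounds the next coefficient by
    (Q - q) sum_i Q^(n - i) q^i = Q^(n+1) - q^(n+1), up to the factor 1 / |a_0|,
    where Q - q = q M / |a_0|. *)
Lemma inverse_coef_bound a (M q : R) :
  a 0%N != 0 -> 0 < q -> 0 <= M -> (forall k, modulus (a k) <= M * q ^+ k) ->
  forall n, modulus (inverse_coef a n) <=
    (modulus (a 0%N))^-1 * (q * (1 + M / modulus (a 0%N))) ^+ n.
Proof.
move=> a0 q0 M0 ak; set A := modulus (a 0%N); set Q := q * _.
have A0 : 0 < A by rewrite modulus_gt0.
have K0 : 0 <= M / A by rewrite divr_ge0 // ltW.
have qQ : q <= Q by rewrite /Q ler_peMr ?(ltW q0) // lerDl.
have Q0 : 0 <= Q by lra.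
elim/ltn_ind => -[|n] IH; first by rewrite inverse_coef0 modulusV expr0 mulr1.
rewrite inverse_coefS modulusM modulusN modulusV -/A.
rewrite ler_wpM2l ?invr_ge0 ?(ltW A0) //.
rewrite (le_trans (modulus_sum _ _ _)) //.
rewrite (@le_trans _ _ (\sum_(i < n.+1) (M / A * q) * (Q ^+ (n.+1.-1 - i) * q ^+ i))) //.
  apply: ler_sum => i _; rewrite modulusM.
  have -> : M / A * q * (Q ^+ (n - i) * q ^+ i) =
     (M * q ^+ i.+1) * (A^-1 * Q ^+ (n - i)) by rewrite exprS; ring.
  apply: ler_pM => //; try exact: modulus_ge0.
  by apply: IH; rewrite ltnS leq_subr.
rewrite -big_distrr /= (_ : M / A * q = Q - q); last by rewrite /Q; ring.
have /= <- := subrXX Q q n.+1.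
by rewrite lerBlDr lerDl exprn_ge0 // ltW.
Qed.

(** The partial sums A_n of f and B_n of the formal inverse satisfy
    A_n B_n --> 1 by [cauchy_prod_error_cvg], and A_n --> f (z + h) <> 0; hence
    B_n --> 1 / f (z + h). *)
Lemma holomorphicV f z :
  holomorphic_at f z -> f z != 0 -> holomorphic_at (fun w => (f w)^-1) z.
Proof.
move=> /holomorphic_expansion[a [M [q Ef]]] fz0.
have [q0 M0 _ _] := Ef; have fza := expansion_at Ef.
have a0 : a 0%N != 0 by rewrite -fza.
have [_ _ ak _] := Ef; have bk := inverse_coef_bound a0 q0 M0 ak.
set A := modulus (a 0%N) in bk; set Q := q * _ in bk.
have A0 : 0 < A by rewrite modulus_gt0.
have K0 : 0 <= M / A by rewrite divr_ge0 // ltW.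
have qQ : q <= Q by rewrite /Q ler_peMr ?(ltW q0) // lerDl.
have Q0 : 0 < Q by lra.
have E := expansion_weaken (lexx M) qQ Ef.
have [d d0 Hd] : exists2 d : R, 0 < d & forall w, modulus (w - z) < d -> f w != 0.
  have /continuous_modulusP/(_ A A0)[d d0 Hd] := expansion_continuous Ef.
  exists d => // w /Hd; apply: contraTneq => ->.
  by rewrite sub0r modulusN fza -leNgt.
apply: (@expansion_holomorphic _ _ _ (inverse_coef a) A^-1 (Q + d^-1)).
have di : 0 < d^-1 by rewrite invr_gt0.
split; [lra|by rewrite invr_ge0 ltW| |].
  move=> k; rewrite (le_trans (bk k)) // ler_wpM2l ?invr_ge0 ?(ltW A0) //.
  by rewrite lerXn2r ?nnegrE; lra.
move=> h hq; have h0 := modulus_ge0 h.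
have Qh : 0 <= Q * modulus h by rewrite mulr_ge0 // ltW.
have dh : 0 <= d^-1 * modulus h by rewrite mulr_ge0 // ltW.
have hQ : Q * modulus h <= 4^-1 by lra.
have fh : f (z + h) != 0.
  apply: Hd; rewrite addrAC subrr add0r.
  have : d^-1 * modulus h < 1 by lra.
  by rewrite mulrC ltr_pdivrMr // mul1r.
have Ai0 : 0 <= A^-1 by rewrite invr_ge0 ltW.
have [_ _ aQ HE] := E.
have P := cauchy_prod_error_cvg Q0 M0 Ai0 aQ bk hQ.
have Pa := HE _ hQ.
have P1 : psum a h n * psum (inverse_coef a) h n @[n --> \oo] --> (1 : C).
  have P' : psum a h n * psum (inverse_coef a) h n - 1 @[n --> \oo] --> (0 : C).
    apply/cvg_modulusP => e e0; have /cvg_modulusP/(_ e e0)[N HN] := P.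
    exists N.+1 => -[//|n] Nn; have := HN _ (ltnW Nn).
    suff -> : psum (cauchy_prod a (inverse_coef a)) h n.+1 = 1 by rewrite subr0.
    rewrite /psum big_ord_recl cauchy_inverse // expr0 mulr1.
    by rewrite big1 ?addr0 // => i _; rewrite cauchy_inverse // mul0r.
  rewrite -[X in _ --> X]add0r.
  rewrite (_ : (fun n => _) = fun n => (psum a h n * psum (inverse_coef a) h n - 1) + 1).
    by apply: (cvgD P'); exact: cvg_cst.
  by apply/funext => n; rewrite subrK.
have P2 : (psum a h n)^-1 @[n --> \oo] --> (f (z + h))^-1.
  exact: (cvgV fh Pa).
have P3 : psum a h n * psum (inverse_coef a) h n * (psum a h n)^-1
    @[n --> \oo] --> (f (z + h))^-1.
  by rewrite -[(f _)^-1]mul1r; exact: cvgM P1 P2.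
have fh' : 0 < modulus (f (z + h)) by rewrite modulus_gt0.
have [N HN] := (cvg_modulusP _ _).1 Pa _ fh'.
apply/cvg_modulusP => e e0; have [N1 HN1] := (cvg_modulusP _ _).1 P3 e e0.
exists (maxn N N1) => n; rewrite geq_max => /andP[/HN Hn /HN1].
have pn0 : psum a h n != 0.
  by apply: contraTneq Hn => ->; rewrite sub0r modulusN ltxx.
by rewrite (_ : _ * _ = psum (inverse_coef a) h n) //= mulrAC divff // mul1r.
Qed.

End Products.

(** * Complex derivatives *)

Section Continuity.
Variable K : numFieldType.
Implicit Types (f g : K -> K) (z : K).

(** Continuity at a point, for functions written pointwise. *)
Lemma continuous_at_cst (c z : K) : {for z, continuous (fun=> c : K)}.
Proof. exact: cst_continuous. Qed.

Lemma continuous_at_sub (c z : K) : {for z, continuous (fun w : K => w - c)}.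
Proof. by apply: continuousB; [move=> P|exact: cst_continuous]. Qed.

Lemma continuous_atD f g z : {for z, continuous f} -> {for z, continuous g} ->
  {for z, continuous (fun w => f w + g w)}.
Proof. by move=> fz gz; apply: continuousD. Qed.

Lemma continuous_atN f z : {for z, continuous f} -> {for z, continuous (fun w => - f w)}.
Proof. by move=> fz; apply: continuousN. Qed.

Lemma continuous_atM f g z : {for z, continuous f} -> {for z, continuous g} ->
  {for z, continuous (fun w => f w * g w)}.
Proof. by move=> fz gz; apply: continuousM. Qed.

Lemma continuous_atV f z : f z != 0 -> {for z, continuous f} ->
  {for z, continuous (fun w => (f w)^-1)}.
Proof. by move=> fz0 fz; apply: continuousV. Qed.

Lemma continuous_at_comp f g z : {for z, continuous g} -> {for g z, continuous f} ->
  {for z, continuous (fun w => f (g w))}.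
Proof. by move=> gz fz; exact: (continuous_comp gz fz). Qed.

End Continuity.

Section Derivatives.
Variable R : realType.
Local Notation C := (CC R).
Implicit Types (a b : nat -> C) (f g : C -> C) (z h d : C) (q t : R).

(** Caratheodory's form of differentiability: the difference quotient extends
    continuously.  The rules of calculus become algebraic identities. *)
Definition has_derivative f z d : Prop :=
  exists s : C -> C, [/\ {for z, continuous s}, s z = d
    & forall w, f w = f z + (w - z) * s w].

Lemma has_derivative_continuous f z d : has_derivative f z d -> {for z, continuous f}.
Proof.
move=> [s [sz _ fE]].
rewrite (funext fE); apply: continuous_atD; first exact: continuous_at_cst.
by apply: continuous_atM sz; exact: continuous_at_sub.
Qed.

Lemma has_derivative_derive1 f z d : has_derivative f z d -> derive1 f z = d.
Proof.
move=> [s [sz sd fE]]; rewrite /derive1; apply: cvg_lim; first exact: norm_hausdorff.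
rewrite -sd => P /sz/nbhs_modulusP[e e0 He].
apply/nbhs_modulusP; exists e => // h; rewrite subr0 => he h0.
rewrite /= fE addrAC subrr add0r addrK /GRing.scale /= mulKf //.
by apply: He; rewrite addrK.
Qed.

Lemma holomorphic_continuous f z : holomorphic_at f z -> {for z, continuous f}.
Proof. by move=> /holomorphic_expansion[a [M [q E]]]; exact: expansion_continuous E. Qed.

Lemma holomorphic_div f z : holomorphic_at f z ->
  exists2 g, holomorphic_at g z & g z = derive1 f z /\
    forall w, f w = f z + (w - z) * g w.
Proof.
move=> /holomorphic_expansion[a [M [q E]]]; have [g [Eg fg]] := expansion_div E.
have fg' w : f w = f z + (w - z) * g w by rewrite (expansion_at E).
exists g; first exact: expansion_holomorphic Eg.
split; last exact: fg'.
apply/esym/has_derivative_derive1; exists g.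
by split; [exact: expansion_continuous Eg| |].
Qed.

Lemma holomorphic_derivative f z :
  holomorphic_at f z -> has_derivative f z (derive1 f z).
Proof.
move=> /holomorphic_div[g gh [gz fg]].
by exists g; split; [exact: holomorphic_continuous| |].
Qed.

Lemma has_derivative_cst (c z : C) : has_derivative (fun=> c) z 0.
Proof.
exists (fun=> 0); split; [exact: continuous_at_cst|by []|].
by move=> w; rewrite mulr0 addr0.
Qed.

Lemma has_derivative_affine (c e z : C) : has_derivative (fun w => c * w + e) z c.
Proof.
exists (fun=> c); split; [exact: continuous_at_cst|by []|].
by move=> w; ring.
Qed.

Lemma has_derivativeD f g z d e : has_derivative f z d -> has_derivative g z e ->
  has_derivative (fun w => f w + g w) z (d + e).
Proof.
move=> [s [sz <- fs]] [t [tz <- gt]]; exists (fun w => s w + t w).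
split; [exact: (continuous_atD sz tz)|by []|].
by move=> w; rewrite (fs w) (gt w); ring.
Qed.

Lemma has_derivativeM f g z d e : has_derivative f z d -> has_derivative g z e ->
  has_derivative (fun w => f w * g w) z (d * g z + f z * e).
Proof.
move=> [s [sz <- fs]] Hg; have gc := has_derivative_continuous Hg.
have [t [tz <- gt]] := Hg; exists (fun w => s w * g w + f z * t w).
split; [|by []|].
  have c1 := continuous_atM sz gc.
  have c2 := continuous_atM (@continuous_at_cst C (f z) z) tz.
  exact (continuous_atD c1 c2).
by move=> w; rewrite (fs w) (gt w); ring.
Qed.

Lemma has_derivativeV f z d : f z != 0 -> has_derivative f z d ->
  has_derivative (fun w => (f w)^-1) z (- d / f z ^+ 2).
Proof.
move=> fz0 Hf; have fc := has_derivative_continuous Hf.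
have [s [sz sd fs]] := Hf.
exists (fun w => if f w == 0 then - (f z)^-1 / (w - z) else - s w * ((f w)^-1 * (f z)^-1)).
have lim : {for z, continuous (fun w => - s w * ((f w)^-1 * (f z)^-1))}.
  have fzV := @continuous_at_cst C (f z)^-1 z.
  exact: (continuous_atM (continuous_atN sz) (continuous_atM (continuous_atV fz0 fc) fzV)).
split.
- move=> P; rewrite (negbTE fz0) => /lim/nbhs_modulusP[e e0 He].
  have fz1 : 0 < modulus (f z) by rewrite modulus_gt0.
  have [e' e'0 He'] := (continuous_modulusP _ _).1 fc _ fz1.
  apply/nbhs_modulusP; exists (Num.min e e'); first by rewrite lt_min e0.
  move=> w; rewrite lt_min => /andP[/He we /He' we'] /=; case: eqP => // fw.
  by move: we'; rewrite fw sub0r modulusN ltxx.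
- by rewrite (negbTE fz0) sd expr2 invfM.
- move=> w; case: eqP => [fw|/eqP fw0].
    have wz : w - z != 0.
      by apply: contraNneq fz0 => wz; have := fs w; rewrite wz mul0r addr0 fw => <-.
    by rewrite fw invr0 mulrC divfK // subrr.
  apply: (mulfI fw0); rewrite divff // mulrDr.
  have -> : f w / f z = 1 + (w - z) * s w / f z by rewrite {1}(fs w) mulrDl divff.
  have -> : f w * ((w - z) * (- s w * ((f w)^-1 * (f z)^-1))) =
    (f w / f w) * - ((w - z) * s w / f z) by ring.
  by rewrite divff // mul1r addrK.
Qed.

Lemma has_derivative_comp f g z d e : has_derivative g z e -> has_derivative f (g z) d ->
  has_derivative (fun w => f (g w)) z (d * e).
Proof.
move=> Hg [s [sz <- fs]]; have gc := has_derivative_continuous Hg.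
have [t [tz <- gt]] := Hg; exists (fun w => s (g w) * t w); split; [|by []|].
  exact: (continuous_atM (continuous_at_comp gc sz) tz).
move=> w; have E : g w - g z = (w - z) * t w.
  by rewrite {1}(gt w) addrAC subrr add0r.
by rewrite (fs (g w)) E -mulrA [t w * _]mulrC.
Qed.

(** The second-order Taylor remainder E_n of y^n at x satisfies
    E_(n+1) = n (y - x)^2 x^(n-1) + y E_n. *)
Lemma pow_remainder (x y : C) (r : R) n : modulus x <= r -> modulus y <= r ->
  modulus (y ^+ n.+2 - x ^+ n.+2 - n.+2%:R * (y - x) * x ^+ n.+1) <=
  modulus (y - x) ^+ 2 * (4 * r) ^+ n.
Proof.
move=> xr yr; have r0 : 0 <= r := le_trans (modulus_ge0 x) xr.
elim: n => [|n IH].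
  rewrite (_ : _ - _ = (y - x) ^+ 2); last by rewrite !expr2; ring.
  by rewrite modulusX expr0 mulr1.
rewrite (_ : _ - _ = n.+2%:R * (y - x) ^+ 2 * x ^+ n.+1 +
  y * (y ^+ n.+2 - x ^+ n.+2 - n.+2%:R * (y - x) * x ^+ n.+1)); last first.
  by rewrite [y ^+ n.+3]exprS [x ^+ n.+3]exprS [x ^+ n.+2]exprS -[n.+3%:R]natr1; ring.
rewrite (le_trans (modulusD _ _)) // [modulus (y * _)]modulusM.
rewrite [modulus (_ * x ^+ _)]modulusM [modulus (n.+2%:R * _)]modulusM.
rewrite [modulus ((y - x) ^+ 2)]modulusX.
have d0 : 0 <= modulus (y - x) ^+ 2 by rewrite exprn_ge0 // modulus_ge0.
set d2 := modulus (y - x) ^+ 2 in IH d0 *.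
rewrite modulus_nat.
have H1 : modulus (x ^+ n.+1) <= r ^+ n.+1.
  by rewrite modulusX lerXn2r // nnegrE ?modulus_ge0.
have H2 := ler_pM (modulus_ge0 y) (modulus_ge0 _) yr IH.
have H3 : n.+2%:R * d2 * modulus (x ^+ n.+1) <= n.+2%:R * d2 * r ^+ n.+1.
  by rewrite ler_wpM2l // mulr_ge0.
apply: (le_trans (lerD H3 H2)).
have -> : n.+2%:R * d2 * r ^+ n.+1 + r * (d2 * (4 * r) ^+ n) =
  (n.+2%:R + 4 ^+ n) * (d2 * r ^+ n.+1) by rewrite !exprMn exprS; ring.
have -> : d2 * (4 * r) ^+ n.+1 = 4 ^+ n.+1 * (d2 * r ^+ n.+1).
  by rewrite exprMn; ring.
apply: ler_wpM2r; first exact: mulr_ge0 d0 (exprn_ge0 _ r0).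
rewrite -!natrX -natrD ler_nat.
rewrite expnS (_ : 4 = 3 + 1)%N // mulnDl mul1n leq_add2r.
have n4 := ltn_expl n (isT : 1 < 4)%N.
by rewrite mulSn (leq_trans (n4 : (n.+2 <= (4 ^ n).+1)%N)) // -addn1 leq_add2l muln_gt0 expn_gt0.
Qed.

Definition deriv_coef a (k : nat) : C := k.+1%:R * a k.+1.

Lemma psum_remainder a (M q : R) (x y : C) n :
  0 < q -> 0 <= M -> (forall k, modulus (a k) <= M * q ^+ k) ->
  q * modulus x <= 8^-1 -> q * modulus y <= 8^-1 ->
  modulus (psum a y n.+2 - psum a x n.+2 - (y - x) * psum (deriv_coef a) x n.+1) <=
  2 * M * q ^+ 2 * modulus (y - x) ^+ 2.
Proof.
move=> q0 M0 ak qx qy; pose r := (8 * q)^-1.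
have r0 : 0 <= r by rewrite invr_ge0; lra.
have xr : modulus x <= r.
  by rewrite /r -div1r ler_pdivlMr; lra.
have yr : modulus y <= r.
  by rewrite /r -div1r ler_pdivlMr; lra.
have d0 : 0 <= M * q ^+ 2 * modulus (y - x) ^+ 2.
  by rewrite !mulr_ge0 // ?exprn_ge0 ?modulus_ge0 ?ltW.
set D := M * q ^+ 2 * _ in d0.
have -> : 2 * M * q ^+ 2 * modulus (y - x) ^+ 2 = 2 * D by rewrite /D; ring.
suff: modulus (psum a y n.+2 - psum a x n.+2 - (y - x) * psum (deriv_coef a) x n.+1)
    <= 2 * D * (1 - 2^-1 ^+ n).
  move=> /le_trans; apply; rewrite -[leRHS]mulr1; apply: ler_wpM2l; first lra.
  by rewrite lerBlDr lerDl exprn_ge0 //; lra.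
elim: n => [|n IH].
  rewrite !psumS !psum0 /deriv_coef expr0 subrr mulr0.
  by rewrite (_ : _ - _ = 0) ?modulus0 // !expr1 !expr0; ring.
rewrite [psum a y _]psumS [psum a x _]psumS [psum (deriv_coef a) x _]psumS.
rewrite (_ : _ - _ = (psum a y n.+2 - psum a x n.+2 - (y - x) * psum (deriv_coef a) x n.+1) +
  a n.+2 * (y ^+ n.+2 - x ^+ n.+2 - n.+2%:R * (y - x) * x ^+ n.+1)); last first.
  by rewrite /deriv_coef; ring.
rewrite (le_trans (modulusD _ _)) // modulusM.
have := ler_pM (modulus_ge0 _) (modulus_ge0 _) (ak n.+2) (pow_remainder n xr yr).
have -> : M * q ^+ n.+2 * (modulus (y - x) ^+ 2 * (4 * r) ^+ n) =
   D * (q * (4 * r)) ^+ n by rewrite /D [in RHS]exprMn -addn2 exprD; ring.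
have qn0 : q != 0 by rewrite gt_eqF.
have -> : q * (4 * r) = 2^-1 by rewrite /r; field.
rewrite [2^-1 ^+ n.+1]exprS; move: (2^-1 ^+ n) IH => p IH H; lra.
Qed.

(** The derived series is compared with the difference quotients of f at z + h.
    As f is already known to be differentiable there, the limit of the derived
    series is identified, and its existence proved, by the uniform bound of
    [psum_remainder]. *)
Lemma entire_derive1 f : entire f -> entire (derive1 f).
Proof.
move=> fent z; have /holomorphic_expansion[a [M [q E]]] := fent z.
have [q0 M0 ak Ha] := E.
apply: (@expansion_holomorphic _ _ _ (deriv_coef a) (M * q) (4 * q)).
split; [lra|by rewrite mulr_ge0 // ltW| |].
  move=> k; rewrite /deriv_coef modulusM.
  rewrite modulus_nat.
  have -> : M * q * (4 * q) ^+ k = 4 ^+ k * (M * q ^+ k.+1) by rewrite exprMn exprS; ring.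
  apply: ler_pM => //; first exact: modulus_ge0.
  by rewrite -natrX ler_nat ltn_expl.
move=> h hq; apply/cvg_modulusP => e e0.
have h0 := modulus_ge0 h.
have [s [/continuous_modulusP sc sz fs]] := holomorphic_derivative (fent (z + h)).
have [d d0 Hd] : exists2 d : R, 0 < d & forall w, modulus (w - (z + h)) < d ->
    modulus (s w - derive1 f (z + h)) < e / 4.
  by rewrite -sz; apply: sc; lra.
have K0 : 0 < 8 * (M * q ^+ 2) + 1.
  by have : 0 <= M * q ^+ 2 by [rewrite mulr_ge0 // exprn_ge0 // ltW]; lra.
(* The step keeps h' in the disc of [psum_remainder], makes the remainder
   bound at most e t / 4, and keeps h' where s is within e / 4 of its limit. *)
pose t := Num.min (Num.min (16 * q)^-1 (e / (8 * (M * q ^+ 2) + 1))) (d / 2).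
have t0 : 0 < t.
  rewrite !lt_min invr_gt0; apply/andP; split; last lra.
  by apply/andP; split; [lra|exact: divr_gt0].
have td : t < d by have : t <= d / 2 by [rewrite ge_min lexx orbT]; lra.
have tq : t * (16 * q) <= 1.
  by rewrite -ler_pdivlMr ?div1r ?ge_min ?lexx //; lra.
have te : t * (8 * (M * q ^+ 2) + 1) <= e.
  by rewrite -ler_pdivlMr // !ge_min lexx !orbT.
pose h' := h + ofR t.
have hh : h' - h = ofR t by rewrite /h' addrAC subrr add0r.
have mt : modulus (h' - h) = t by rewrite hh modulus_ofR ger0_norm // ltW.
have mh' : modulus h' <= modulus h + t.
  by rewrite (le_trans (modulusD _ _)) // modulus_ofR ger0_norm // ltW.
have qh' : q * modulus h' <= 8^-1.
  have : q * modulus h' <= q * (modulus h + t) by rewrite ler_wpM2l // ltW.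
  by lra.
have qh : q * modulus h <= 8^-1.
  by have : 0 <= q * modulus h by [rewrite mulr_ge0 // ltW]; lra.
have et : 0 < e * t / 8 by rewrite divr_gt0 ?mulr_gt0.
have le84 : 8^-1 <= 4^-1 :> R by lra.
have [N1 HN1] := (cvg_modulusP _ _).1 (Ha h (le_trans qh le84)) _ et.
have [N2 HN2] := (cvg_modulusP _ _).1 (Ha h' (le_trans qh' le84)) _ et.
exists (maxn N1 N2).+1 => -[//|n]; rewrite ltnS geq_max => /andP[n1 n2].
have A1 := HN1 n.+2 (leq_trans n1 (leq_trans (leqnSn _) (leqnSn _))).
have A2 := HN2 n.+2 (leq_trans n2 (leq_trans (leqnSn _) (leqnSn _))).
have A3 := psum_remainder n q0 M0 ak qh qh'.
have A4 : modulus (s (z + h') - derive1 f (z + h)) < e / 4.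
  by apply: Hd; rewrite opprD addrACA subrr add0r mt.
have fh : f (z + h') = f (z + h) + (h' - h) * s (z + h').
  by rewrite fs; congr (_ + _ * _); ring.
rewrite -(ltr_pM2l t0) -{1}mt -modulusM.
set X := psum a (h') _ in A2 A3; set Y := psum a h _ in A1 A3.
set P := psum _ h _ in A3 *; set L := derive1 f _ in A4 *.
(* P - L is compared with the difference quotient of step h' - h. *)
have -> : (h' - h) * (P - L) = - (X - Y - (h' - h) * P) + (X - f (z + h'))
   - (Y - f (z + h)) + (h' - h) * (s (z + h') - L) by rewrite fh; ring.
apply: le_lt_trans (modulusD _ _) _; rewrite modulusM mt.
have B1 := modulusB (- (X - Y - (h' - h) * P) + (X - f (z + h'))) (Y - f (z + h)).
have B2 := modulusD (- (X - Y - (h' - h) * P)) (X - f (z + h')).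
rewrite modulusN in B2.
have B3 : t * modulus (s (z + h') - L) <= t * (e / 4) by rewrite ler_wpM2l ?ltW.
rewrite mt in A3.
have B4 : 2 * M * q ^+ 2 * t ^+ 2 <= t * (e / 4).
  have -> : 2 * M * q ^+ 2 * t ^+ 2 = t * (t * (2 * (M * q ^+ 2))) by ring.
  by apply: ler_wpM2l; [exact: ltW|lra].
have et' : 0 < e * t by rewrite mulr_gt0.
lra.
Qed.

End Derivatives.

(** * Periodic entire functions are constant *)

Section Liouville.
Variable R : realType.
Local Notation C := (CC R).
Implicit Types (a b : nat -> C) (f g : C -> C) (z h d : C) (q t : R).

(** Let f = a_0 + (w - z)^n g with g z = a_n <> 0 and n > 0.  If a_0 <> 0, then
    moving in a direction v with a_n v^n = a_0 increases |f|, since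
    f (z + s v) is close to a_0 (1 + s^n). *)
Lemma local_maximum f z (r : R) : holomorphic_at f z -> 0 < r ->
  (forall w, modulus (w - z) < r -> modulus (f w) <= modulus (f z)) ->
  exists2 r' : R, 0 < r' & forall w, modulus (w - z) < r' -> f w = f z.
Proof.
move=> /holomorphic_expansion[a [M [q E]]] r0 fmax.
have [q0 M0 ak Ha] := E; have fz := expansion_at E.
have [fz0|fz0] := eqVneq (f z) 0.
  exists r => // w /fmax; rewrite fz0 modulus0 => fw.
  by apply/eqP; rewrite -modulus_eq0 eq_le fw modulus_ge0.
have [[k ak0]|noa] := pselect (exists k, a k.+1 != 0); last first.
  exists (4 * q)^-1; first by rewrite invr_gt0; lra.
  move=> w; rewrite -div1r ltr_pdivlMr ?mulr_gt0 // => wq.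
  have hq : q * modulus (w - z) <= 4^-1 by lra.
  have := Ha _ hq; rewrite [z + _]addrC subrK => cv.
  apply: modulus_small_eq => e e0; rewrite (@le_trans _ _ 0) ?(ltW e0) //.
  apply: (cvg_modulus_le cv); exists 1%N => -[//|n] _.
  rewrite /psum big_ord_recl expr0 mulr1 big1 => [|i _].
    by rewrite addr0 fz subrr modulus0.
  have [->|ai] := eqVneq (a (lift ord0 i)) 0; first by rewrite mul0r.
  by case: noa; exists i.
have [n an0 nmin] := @ex_minnP (fun k => a k.+1 != 0) (ex_intro _ k ak0).
have [g [gh [gz fg]]] := expansion_divX n.+1 E.
have {}fg w : f w = f z + (w - z) ^+ n.+1 * g w.
  rewrite fg big_ord_recl expr0 mulr1 big1 ?addr0 -?fz // => i _.
  have [->|ai] := eqVneq (a (lift ord0 i)) 0; first by rewrite mul0r.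
  by have := nmin _ ai; rewrite leqNgt ltn_ord.
(* The direction along which the leading term is a positive multiple of f z. *)
pose v : C := n.+1.-root (f z / a n.+1).
have vn : v ^+ n.+1 = f z / a n.+1 by rewrite /v rootCK.
have v0 : v != 0.
  apply: contraNneq fz0 => v0; move: vn; rewrite v0 expr0n /= => /esym/eqP.
  by rewrite mulf_eq0 invr_eq0 (negbTE an0) orbF.
have man : 0 < modulus (a n.+1) / 2 by rewrite divr_gt0 // modulus_gt0.
have [d d0 gd] := (continuous_modulusP _ _).1 (holomorphic_continuous gh) _ man.
have v1 : 0 < modulus v by rewrite modulus_gt0.
pose s : R := Num.min r d / (2 * modulus v).
have m0 : 0 < Num.min r d by rewrite lt_min r0.
have s0 : 0 < s by rewrite divr_gt0 // mulr_gt0.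
pose w : C := z + ofR s * v.
have wz : w - z = ofR s * v by rewrite /w addrAC subrr add0r.
have mwz : modulus (w - z) < Num.min r d.
  rewrite wz modulusM modulus_ofR ger0_norm ?ltW //.
  have -> : s * modulus v = Num.min r d / 2.
    by rewrite /s invfM mulrA mulfVK // gt_eqF.
  by lra.
move: mwz; rewrite lt_min => /andP[/fmax fwz /gd gwz].
exfalso; move: fwz; apply/negP; rewrite -ltNge.
pose u := g w / a n.+1.
have u1 : modulus (u - 1) <= 2^-1.
  have -> : u - 1 = (g w - g z) / a n.+1 by rewrite gz mulrBl divff.
  rewrite modulusM modulusV ler_pdivrMr ?modulus_gt0 //; lra.
have -> : f w = f z * (1 + ofR (s ^+ n.+1) * u).
  by rewrite fg wz exprMn vn ofRX /u; ring.
rewrite modulusM -{1}[modulus (f z)]mulr1 ltr_pM2l ?modulus_gt0 //.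
have sn0 : 0 < s ^+ n.+1 by rewrite exprn_gt0.
have : modulus (ofR (1 + s ^+ n.+1)) = 1 + s ^+ n.+1.
  by rewrite modulus_ofR ger0_norm //; lra.
have -> : ofR (1 + s ^+ n.+1) =
  (1 + ofR (s ^+ n.+1) * u) - ofR (s ^+ n.+1) * (u - 1) :> C.
  by rewrite ofRD (_ : ofR 1 = 1) //; ring.
move=> H; have := modulusB (1 + ofR (s ^+ n.+1) * u) (ofR (s ^+ n.+1) * (u - 1)).
rewrite H modulusM modulus_ofR ger0_norm; last exact: ltW.
have : s ^+ n.+1 * modulus (u - 1) <= s ^+ n.+1 * 2^-1 by rewrite ler_wpM2l // ltW.
by lra.
Qed.

(** Along the segment from z0 to w, the set where f takes the value f z0 is
    closed by continuity and open by [local_maximum]. *)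
Lemma maximum_principle f z0 : entire f ->
  (forall w, modulus (f w) <= modulus (f z0)) -> forall w, f w = f z0.
Proof.
move=> fent fmax w.
pose p (t : R) : C := z0 + ofR t * (w - z0).
have pB t t' : modulus (p t' - p t) = `|t' - t| * modulus (w - z0).
  have -> : p t' - p t = ofR (t' - t) * (w - z0) by rewrite /p ofRB; ring.
  by rewrite modulusM modulus_ofR.
have K0 := modulus_ge0 (w - z0); set K := modulus (w - z0) in pB K0.
have pball t (r : R) : 0 < r -> \forall t' \near t, modulus (p t' - p t) < r.
  move=> r0; apply/nbhs_ballP; exists (r / (K + 1)); first by rewrite /= divr_gt0 //; lra.
  move=> t'; rewrite /ball /= distrC ltr_pdivlMr; last lra.
  by rewrite pB; have := normr_ge0 (t' - t); lra.
have conn : connected [set: R] by apply/connected_intervalP => x y _ _ z _.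
suff /seteqP[_ /(_ 1 I)] : [set t | f (p t) = f z0] = setT.
  by rewrite /= /p (_ : ofR 1 = 1) // mul1r addrC subrK.
apply: conn.
- by exists 0; rewrite /= /p (_ : ofR 0 = 0) // mul0r addr0.
- exists [set t | f (p t) = f z0]; last by rewrite setTI.
  rewrite openE => t /= ft.
  have [r r0 Hr] : exists2 r' : R, 0 < r' & forall w, modulus (w - p t) < r' -> f w = f (p t).
    apply: (@local_maximum f (p t) 1) => // w' _; by rewrite ft.
  by apply: filterS (pball t r r0) => t' /Hr ft' /=; rewrite ft'.
- exists [set t | f (p t) = f z0]; last by rewrite setTI.
  rewrite -openC openE => t /= ft.
  have m0 : 0 < modulus (f (p t) - f z0).
    by rewrite modulus_gt0 subr_eq0; apply/eqP.
  have [r r0 Hr] := (continuous_modulusP _ _).1 (holomorphic_continuous (fent (p t))) _ m0.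
  apply: filterS (pball t r r0) => t' /Hr H fp; move: H; rewrite fp.
  by rewrite modulusC ltxx.
Qed.

(** Real coordinates of z in the basis w1, w2, rounded down. *)
Lemma lattice_floor (w1 w2 : C) : 'Im (w2 / w1) != 0 ->
  forall z, exists (m n : int) (s t : R),
    [/\ 0 <= s <= 1, 0 <= t <= 1 &
        z = (m%:~R * w1 + n%:~R * w2) + (ofR s * w1 + ofR t * w2)].
Proof.
move=> im0 z; have w10 : w1 != 0.
  by apply: contraNneq im0 => ->; rewrite invr0 mulr0 raddf0.
pose tau : R[i] := w2 / w1; pose zz : R[i] := z / w1.
have tau0 : complex.Im tau != 0.
  by apply: contraNneq im0; rewrite -complexIm => ->.
pose t : R := complex.Im zz / complex.Im tau.
pose s : R := complex.Re zz - t * complex.Re tau.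
have zE : z = ofR s * w1 + ofR t * w2.
  have : zz = ofR s + ofR t * tau.
    rewrite /ofR; apply/eqP; rewrite eq_complex /=; apply/andP; split; apply/eqP.
      by rewrite /s; case: (tau) => x y /=; ring.
    by rewrite /t; case: (tau) tau0 => x y /= y0; field.
  move=> zzE; have -> : z = (zz : C) * w1 by rewrite /zz divfK.
  by rewrite zzE mulrDl -mulrA /tau divfK.
exists (Num.floor s), (Num.floor t), (s - (Num.floor s)%:~R), (t - (Num.floor t)%:~R).
have itv (u : R) : 0 <= u - (Num.floor u)%:~R <= 1.
  by have /andP[] := floor_itv u; rewrite intrD; lra.
split; [exact: itv|exact: itv|].
have ofRz (n : int) : ofR (n%:~R : R) = n%:~R :> C by rewrite /ofR rmorph_int.
by rewrite {1}zE !ofRB !ofRz; ring.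
Qed.

(** The modulus of f attains its maximum on the compact fundamental
    parallelogram, hence on C. *)
Lemma periodic_entire_cst (L : set C) f : is_lattice L -> entire f ->
  (forall l z, L l -> f (z + l) = f z) -> forall z, f z = f 0.
Proof.
move=> [w1 [w2 [im0 LE]]] fent fper.
pose p (c : R * R) : C := ofR c.1 * w1 + ofR c.2 * w2.
pose A : set (R * R) := `[0, 1]%classic `*` `[0, 1]%classic.
have Acpt : compact A by apply: compact_setX; exact: segment_compact.
have A0 : A !=set0 by exists (0, 0); split; rewrite /= in_itv /= lexx ler01.
have cont : continuous (fun c => modulus (f (p c))).
  move=> c P /nbhs_ballP[e /= e0 eP].
  have [d d0 Hd] := (continuous_modulusP _ _).1 (holomorphic_continuous (fent (p c))) _ e0.
  have W0 : 0 < modulus w1 + modulus w2 + 1.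
    by have := modulus_ge0 w1; have := modulus_ge0 w2; lra.
  set r := d / (modulus w1 + modulus w2 + 1).
  have r0 : 0 < r by rewrite divr_gt0.
  exists (ball c.1 r, ball c.2 r); first by split; exact: nbhsx_ballx.
  move=> c' [/= H1 H2]; apply: eP; rewrite /ball /=.
  have H : modulus (p c' - p c) < d.
    have -> : p c' - p c = ofR (c'.1 - c.1) * w1 + ofR (c'.2 - c.2) * w2.
      by rewrite /p !ofRB; ring.
    apply: le_lt_trans (modulusD _ _) _; rewrite !modulusM !modulus_ofR.
    move: H1 H2; rewrite /ball /= distrC => H1; rewrite distrC => H2.
    have dE : d = r * (modulus w1 + modulus w2 + 1) by rewrite /r divfK // gt_eqF.
    have := ler_wpM2r (modulus_ge0 w1) (ltW H1).
    have := ler_wpM2r (modulus_ge0 w2) (ltW H2).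
    by rewrite dE; lra.
  apply: le_lt_trans (Hd _ H).
  rewrite ler_norml; apply/andP; split.
    have := modulusD (f (p c)) (f (p c') - f (p c)); rewrite addrC subrK; lra.
  have := modulusB (f (p c')) (f (p c') - f (p c)).
  by rewrite opprB addrCA subrr addr0; lra.
have [c _ cmax] := compact_EVT_max A0 Acpt (continuous_subspaceT cont).
have fmax w : modulus (f w) <= modulus (f (p c)).
  have [m [n [s [t [s01 t01 wE]]]]] := lattice_floor im0 w.
  have -> : f w = f (p (s, t)).
    rewrite wE addrC fper // LE; by exists m, n.
  by apply: cmax; rewrite inE; split; rewrite /= in_itv.
by move=> z; rewrite !(maximum_principle fent fmax).
Qed.

End Liouville.

(** * The logarithmic derivative of theta *)

Section Local.
Variable R : realType.
Local Notation C := (CC R).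
Implicit Types (f g : C -> C) (z d : C).

Lemma has_derivative_near f g z d :
  (\forall w \near z, f w = g w) -> has_derivative g z d -> has_derivative f z d.
Proof.
move=> /nbhs_modulusP[r r0 fg] [s [sc sz gs]].
exists (fun w => if w == z then d else (f w - f z) / (w - z)); split.
- move=> P; rewrite eqxx -sz => /sc/nbhs_modulusP[e e0 He].
  apply/nbhs_modulusP; exists (Num.min r e); first by rewrite lt_min r0.
  move=> w; rewrite lt_min => /andP[wr /He we] /=; case: eqP => [wz|/eqP wz].
    by move: we; rewrite wz.
  rewrite fg // fg ?subrr ?modulus0 // gs addrAC subrr add0r mulrC mulKf //.
  by rewrite subr_eq0.
- by rewrite eqxx.
- move=> w; case: eqP => [->|/eqP wz]; first by rewrite subrr mul0r addr0.
  by rewrite mulrC divfK ?subr_eq0 // addrC subrK.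
Qed.

Lemma holomorphic_near f g z :
  (\forall w \near z, f w = g w) -> holomorphic_at g z -> holomorphic_at f z.
Proof.
move=> /nbhs_modulusP[r r0 fg] /holomorphic_expansion[a [M [q E]]].
have ri : 0 < r^-1 by rewrite invr_gt0.
have qr : q <= q + r^-1 by rewrite lerDl ltW.
have [q0 M0 ak H] := expansion_weaken (lexx M) qr E.
have [q1 _ _ _] := E.
apply: (@expansion_holomorphic _ f z a M (q + r^-1)).
split; [exact: q0|exact: M0|exact: ak|] => h hq.
rewrite fg; first exact: H.
rewrite addrAC subrr add0r.
have : modulus h * r^-1 < 1.
  have : 0 <= q * modulus h by rewrite mulr_ge0 ?modulus_ge0 // ltW.
  by lra.
by rewrite ltr_pdivrMr // mul1r.
Qed.

Lemma holomorphic_sum (I : Type) (s : seq I) (P : pred I) (F : I -> C -> C) z :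
  (forall i, P i -> holomorphic_at (F i) z) ->
  holomorphic_at (fun w => \sum_(i <- s | P i) F i w) z.
Proof.
move=> H; elim: s => [|i s IH].
  rewrite (_ : (fun w => _) = fun=> 0); first exact: holomorphic_cst.
  by apply/funext => w; rewrite big_nil.
have [Pi|nPi] := boolP (P i); last first.
  rewrite (_ : (fun w => _) = fun w => \sum_(j <- s | P j) F j w); first exact: IH.
  by apply/funext => w; rewrite big_cons (negbTE nPi).
rewrite (_ : (fun w => _) = fun w => F i w + \sum_(j <- s | P j) F j w).
  by apply: holomorphicD IH; exact: H.
by apply/funext => w; rewrite big_cons Pi.
Qed.

Lemma continuous_neq0 f z : {for z, continuous f} -> f z != 0 ->
  \forall w \near z, f w != 0.
Proof.
rewrite -modulus_gt0 => /continuous_modulusP fc /fc[d d0 Hd].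
apply/nbhs_modulusP; exists d => // w /Hd; apply: contraTneq => ->.
by rewrite sub0r modulusN ltxx.
Qed.

Lemma expCD z w : expC (z + w) = expC z * expC w :> C.
Proof.
rewrite /expC; case: z => a b; case: w => c d /=.
rewrite expRD cosD sinD; apply/eqP; rewrite eq_complex /=.
by apply/andP; split; apply/eqP; ring.
Qed.

End Local.

Section Theta.
Variable R : realType.
Local Notation C := (CC R).
Variables (L : set C) (theta : C -> C).
Hypotheses (L_lattice : is_lattice L) (theta_L : is_theta L theta).
Implicit Types (f g : C -> C) (z d l : C).

Lemma lattice0 : L 0.
Proof.
have [w1 [w2 [_ ->]]] := L_lattice; exists 0, 0.
by rewrite !mul0r addr0.
Qed.

Lemma latticeD z l : L l -> L (z + l) <-> L z.
Proof.
have [w1 [w2 [_ ->]]] := L_lattice => -[a [b ->]]; split => -[c [d E]].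
  exists (c - a), (d - b); rewrite !intrB !mulrBl.
  by rewrite -[LHS](addrK (a%:~R * w1 + b%:~R * w2)) E; ring.
by exists (c + a), (d + b); rewrite E !intrD; ring.
Qed.

Lemma theta_neq0 z : (theta z != 0) <-> ~ L z.
Proof.
have [_ _ th0 _] := theta_L; split; first by move=> /eqP H /th0.
by move=> H; apply/eqP => /th0.
Qed.

Lemma theta_holomorphic z : holomorphic_at theta z.
Proof. by have [H _ _ _] := theta_L; exact: H. Qed.

Definition logder z : C := derive1 theta z / theta z.

Lemma logder_holomorphic z : ~ L z -> holomorphic_at logder z.
Proof.
move=> /theta_neq0 z0; apply: holomorphicM.
  by apply: entire_derive1 => w; exact: theta_holomorphic.
by apply: holomorphicV => //; exact: theta_holomorphic.
Qed.

(** Write theta = z q; then theta' / theta = (theta' / q) / z, where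
    q 0 = theta' 0 <> 0. *)
Lemma logder_residue : exists g, [/\ holomorphic_at g 0, g 0 = 1,
  (forall z, z != 0 -> logder z = g z / z) & \forall z \near (0 : C)^', ~ L z].
Proof.
have [th_ent _ th0 th'0] := theta_L.
have [q qh [q0 thq]] := holomorphic_div (theta_holomorphic 0).
have th00 : theta 0 = 0 by apply/th0/lattice0.
have q00 : q 0 != 0 by rewrite q0; exact/th'0/lattice0.
have {}thq w : theta w = w * q w by rewrite thq th00 add0r subr0.
exists (fun w => derive1 theta w / q w); split.
- apply: holomorphicM; first exact: (entire_derive1 th_ent).
  exact: holomorphicV.
- by rewrite -q0 divff.
- by move=> z z0; rewrite /logder thq invfM [z^-1 * _]mulrC mulrA.
- have := continuous_neq0 (holomorphic_continuous qh) q00.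
  move=> /nbhs_modulusP[d d0 Hd]; apply/nbhs_modulusP; exists d => // w /Hd qw w0.
  by apply/theta_neq0; rewrite thq mulf_neq0.
Qed.

(** From theta (z + l + h) = expC (a z + b) expC (a h) theta (z + h), by
    differentiation in h at 0.  The function h |-> expC (a h) has a derivative
    at 0 because, for any fixed z off L, it is a quotient of values of theta up
    to a constant factor. *)
Lemma logder_quasiperiodic l : L l ->
  exists k : C, forall z, ~ L z -> logder (z + l) = logder z + k.
Proof.
move=> Ll; have [[z1 /theta_neq0 z10]|nz] := pselect (exists z, ~ L z); last first.
  by exists 0 => z zL; case: nz; exists z.
have [th_ent /(_ l Ll)[a [b qp]] _ _] := theta_L.
have thd z : has_derivative theta z (derive1 theta z).
  exact/holomorphic_derivative/theta_holomorphic.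
have shiftd z : has_derivative (fun h => theta (z + h)) 0 (derive1 theta z).
  rewrite -[derive1 theta z]mulr1.
  rewrite (_ : (fun h => _) = fun h => theta (1 * h + z)).
    by apply: has_derivative_comp; [exact: has_derivative_affine|rewrite mulr0 add0r].
  by apply/funext => h; rewrite mul1r addrC.
have expE z h : expC (a * (z + h) + b) = expC (a * z + b) * expC (a * h) :> C.
  by rewrite -expCD; congr expC; ring.
(* h |-> expC (a h) is the quotient theta (z1 + l + h) / theta (z1 + h), up to
   a constant factor. *)
have z1l : theta (z1 + l) != 0 by apply/theta_neq0; rewrite latticeD //; exact/theta_neq0.
have e10 : expC (a * z1 + b) != 0.
  by apply: contraNneq z1l => e10; rewrite qp e10 mul0r.
have [k ck] : exists k, has_derivative (fun h => expC (a * h) : C) 0 k.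
  exists (((derive1 theta (z1 + l)) * (theta (z1 + 0))^-1 + theta (z1 + l + 0) *
    (- derive1 theta z1 / theta (z1 + 0) ^+ 2)) * (expC (a * z1 + b))^-1 +
    theta (z1 + l + 0) * (theta (z1 + 0))^-1 * 0).
  apply: (@has_derivative_near _ _
    (fun h => theta (z1 + l + h) * (theta (z1 + h))^-1 * (expC (a * z1 + b))^-1)).
    have := continuous_neq0 (has_derivative_continuous (shiftd z1)) _.
    rewrite addr0 => /(_ z10); apply: filterS => h th.
    by rewrite addrAC qp expE mulfK // mulrAC divff // mul1r.
  apply: has_derivativeM; last exact: has_derivative_cst.
  apply: has_derivativeM; first exact: shiftd.
  by apply: has_derivativeV; rewrite ?addr0.
exists k => z /theta_neq0 tz.
have zl : theta (z + l) != 0 by apply/theta_neq0; rewrite latticeD //; exact/theta_neq0.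
have e0 : expC (a * z + b) != 0.
  by apply: contraNneq zl => e0; rewrite qp e0 mul0r.
have d1 := has_derivative_derive1 (shiftd (z + l)).
have : has_derivative (fun h => theta (z + l + h)) 0
   (0 * (theta (z + 0) * expC (a * 0)) + expC (a * z + b) *
   (derive1 theta z * expC (a * 0) + theta (z + 0) * k)).
  rewrite (_ : (fun h => _) = fun h => expC (a * z + b) * (theta (z + h) * expC (a * h))).
    apply: has_derivativeM; first exact: has_derivative_cst.
    exact: (has_derivativeM (shiftd z) ck).
  by apply/funext => h; rewrite addrAC qp expE; ring.
move=> /has_derivative_derive1; rewrite d1 mul0r add0r addr0.
have -> : expC (a * 0) = 1 :> C.
  apply: (mulfI e0); rewrite mulr1 -expCD; congr expC; ring.
rewrite mulr1 /logder qp => ->.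
by rewrite -mulf_div divff // mul1r mulrDl [theta z * k]mulrC mulfK.
Qed.

End Theta.

(** * Functions on the elliptic curve with prescribed simple poles *)

Section PrincipalParts.
Variable R : realType.
Local Notation C := (CC R).
Variables (L : set C) (theta : C -> C).
Hypotheses (L_lattice : is_lattice L) (theta_L : is_theta L theta).
Variables (m : nat) (x : 'I_m -> C).
Hypothesis x_distinct : distinct_mod L x.
Implicit Types (f g : C -> C) (z d l : C) (b : 'I_m -> C).

Let pole z := exists i, L (z - x i).

Lemma pole_shift z l : L l -> pole (z + l) <-> pole z.
Proof.
move=> Ll; split=> -[i Hi]; exists i; move: Hi; rewrite addrAC.
  by move/(latticeD L_lattice _ Ll).
by move=> H; apply/(latticeD L_lattice _ Ll).
Qed.

Lemma near_not_pole z : ~ pole z -> \forall w \near z, ~ pole w.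
Proof.
move=> zp.
have H (i : 'I_m) : \forall w \near z, theta (w - x i) != 0.
  apply: (@continuous_neq0 _ (fun w => theta (w - x i))).
    apply: holomorphic_continuous; apply: holomorphic_shift.
    exact: (theta_holomorphic theta_L).
  by apply/(theta_neq0 theta_L) => Lz; apply: zp; exists i.
have : \forall w \near z, forall i, theta (w - x i) != 0.
  exact: (filter_forall (nbhs_filter z) H).
apply: filterS => w Hw [k]; apply/(theta_neq0 theta_L); exact: Hw.
Qed.

Lemma near_pole i : \forall w \near (x i)^', ~ pole w.
Proof.
have H (j : 'I_m) : \forall w \near (x i)^', ~ L (w - x j).
  have [->|ji] := eqVneq j i.
    have [g [_ _ _ /nbhs_modulusP[d d0 Hd]]] := logder_residue L_lattice theta_L.
    apply/nbhs_modulusP; exists d => // w wd wi; apply: Hd; first by rewrite subr0.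
    by rewrite subr_eq0.
  have : \forall w \near x i, theta (w - x j) != 0.
    apply: (@continuous_neq0 _ (fun w => theta (w - x j))).
      apply: holomorphic_continuous; apply: holomorphic_shift.
      exact: (theta_holomorphic theta_L).
    by apply/(theta_neq0 theta_L) => /x_distinct ij; rewrite ij eqxx in ji.
  move=> /nbhs_modulusP[d d0 Hd]; apply/nbhs_modulusP; exists d => // w /Hd tw _.
  exact/(theta_neq0 theta_L).
have : \forall w \near (x i)^', forall j, ~ L (w - x j).
  exact: (filter_forall (dnbhs_filter (x i)) H).
by apply: filterS => w Hw [j]; exact: Hw.
Qed.

(** The difference of the two functions has removable singularities, with the
    value F i 1 - F' i 1 at x i.  It extends to a periodic entire function. *)
Lemma restr_2D_uniq (F F' : 'M[C]_(m, 2)) :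
  restr_2D L x F -> restr_2D L x F' -> (forall i, F i 0 = F' i 0) ->
  exists c : C, forall i, F i 1 = F' i 1 + c.
Proof.
move=> [f [fper fhol fpole]] [f' [fper' fhol' fpole']] FF.
have germ i : exists2 G, holomorphic_at G (x i) &
    (G (x i) = F i 1 - F' i 1 /\ \forall z \near (x i)^', f z - f' z = G z).
  have [g [gh fg g0 g1]] := fpole i; have [g' [gh' fg' g0' g1']] := fpole' i.
  have hD : holomorphic_at (fun w => g w + (-1) * g' w) (x i).
    apply: (holomorphicD gh); apply: (holomorphicM _ gh'); exact: holomorphic_cst.
  have [G Gh [G0 GE]] := holomorphic_div hD.
  exists G; [exact: Gh|split].
    rewrite G0; have := has_derivativeD (holomorphic_derivative gh)
      (has_derivativeM (has_derivative_cst (-1) (x i)) (holomorphic_derivative gh')).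
    by move=> /has_derivative_derive1 ->; rewrite g1 g1'; ring.
  move: fg fg' => /nbhs_modulusP[d d0 Hd] /nbhs_modulusP[d' d'0 Hd'].
  apply/nbhs_modulusP; exists (Num.min d d'); first by rewrite lt_min d0.
  move=> z; rewrite lt_min => /andP[/Hd fz /Hd' f'z] zi.
  have zi0 : z - x i != 0 by rewrite subr_eq0.
  rewrite fz // f'z // -mulrBl; have := GE z.
  by rewrite g0 g0' FF !mulN1r subrr add0r => ->; rewrite mulrC mulKf.
have germ' i : exists G : C -> C, holomorphic_at G (x i) /\
    (G (x i) = F i 1 - F' i 1 /\ \forall z \near (x i)^', f z - f' z = G z).
  by have [G Gh GP] := germ i; exists G.
have [G GP] := choice germ'.
(* The difference, extended over the poles; distinctness of the points of X
   makes the choice of the index irrelevant. *)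
pose h z := if pselect (exists i, L (z - x i)) is left H
  then F (projT1 (cid H)) 1 - F' (projT1 (cid H)) 1 else f z - f' z.
have hpole i z : L (z - x i) -> h z = F i 1 - F' i 1.
  move=> Li; rewrite /h; case: pselect => [H|[]]; last by exists i.
  case: cid => j /= Lj; suff -> : j = i by [].
  apply: x_distinct; apply/(latticeD L_lattice _ Lj).
  by rewrite addrC addrA subrK.
have hreg z : ~ pole z -> h z = f z - f' z.
  by move=> zp; rewrite /h; case: pselect.
have hper l z : L l -> h (z + l) = h z.
  move=> Ll; have [[i Li]|zp] := pselect (pole z).
    rewrite (hpole i z Li) (hpole i) // addrAC; exact/(latticeD L_lattice _ Ll).
  rewrite !hreg // ?fper ?fper' //.
  by move/(pole_shift _ Ll).
have hx i : holomorphic_at h (x i).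
  have [Gh [Gx]] := GP i; move=> /nbhs_modulusP[d d0 Hd].
  have := near_pole i; move=> /nbhs_modulusP[d' d'0 Hd'].
  apply: holomorphic_near Gh.
  apply/nbhs_modulusP; exists (Num.min d d'); first by rewrite lt_min d0.
  move=> w; rewrite lt_min => /andP[/Hd H1 /Hd' H2].
  have [->|wi] := eqVneq w (x i).
    by rewrite Gx (hpole i) // subrr; exact: lattice0.
  by rewrite hreg; [exact: H1|exact: H2].
have h_ent : entire h.
  move=> z; have [[i Li]|zp] := pselect (pole z).
    rewrite (_ : h = fun w => h (w - (z - x i))).
      by apply: holomorphic_shift; rewrite opprB addrC subrK; exact: hx.
    apply/funext => w; have := hper _ (w - (z - x i)) Li.
    by rewrite subrK.
  apply: (@holomorphic_near _ _ (fun w => f w + (-1) * f' w)).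
    apply: filterS (near_not_pole zp) => w wp.
    by rewrite hreg // mulN1r.
  have np i : ~ L (z - x i) by move=> Li; apply: zp; exists i.
  apply: holomorphicD; first exact: fhol.
  by apply: holomorphicM; [exact: holomorphic_cst|exact: fhol'].
have hcst := periodic_entire_cst L_lattice h_ent hper.
exists (h 0) => i; rewrite -(hcst (x i)) (hpole i) ?subrr; last exact: lattice0.
by rewrite addrC subrK.
Qed.

(** The constant term of the Laurent expansion of theta' / theta at 0. *)
Definition zeta_const : C :=
  xget 0 [set k | exists g, [/\ holomorphic_at g 0, g 0 = 1, derive1 g 0 = k
    & forall z, z != 0 -> logder theta z = g z / z]].

(** The finite part at x i of the function theta' / theta (z - x a). *)
Definition zeta_matrix (i a : 'I_m) : C :=
  if a == i then zeta_const else logder theta (x i - x a).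

(** The function is sum_a b_a theta' / theta (z - x_a), set to 0 at the poles:
    there the conventional value of the division by 0 is not periodic.  Its
    quasi-periods cancel since the residues sum to 0. *)
Lemma restr_2D_exists b : \sum_i b i = 0 ->
  restr_2D L x (\matrix_(i, k) if k == 0 then b i else \sum_a zeta_matrix i a * b a).
Proof.
move=> b0; pose S z := \sum_a b a * logder theta (z - x a).
pose f z := if pselect (pole z) then 0 else S z.
exists f; split.
- move=> l z Ll; rewrite /f.
  have [pz1 pz2] := pole_shift z Ll.
  case: pselect => [p1|n1]; case: pselect => [p2|zp] //.
    by case: zp; exact: pz1.
    by case: n1; exact: pz2.
  have [k Hk] := logder_quasiperiodic L_lattice theta_L Ll.
  have -> : S z = S z + k * \sum_a b a by rewrite b0 mulr0 addr0.
  rewrite /S big_distrr -big_split /=.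
  apply: eq_bigr => a _; rewrite addrAC Hk; first by rewrite mulrDr [k * _]mulrC.
  by move=> La; apply: zp; exists a.
- move=> z zp; have zp' : ~ pole z by case.
  apply: (@holomorphic_near _ _ S).
    by apply: filterS (near_not_pole zp') => w wp; rewrite /f; case: pselect.
  apply: holomorphic_sum => a _; apply: holomorphicM; first exact: holomorphic_cst.
  by apply: holomorphic_shift; exact: (logder_holomorphic theta_L).
- move=> i; have [g [gh g0 dg gE]] : exists g, [/\ holomorphic_at g 0, g 0 = 1,
      derive1 g 0 = zeta_const & forall z, z != 0 -> logder theta z = g z / z].
    have [g [gh g0 gE _]] := logder_residue L_lattice theta_L.
    rewrite /zeta_const; case: xgetP => [k _ [g' [? ? <- ?]]|/(_ (derive1 g 0))[]].
      by exists g'.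
    by exists g.
  pose T z := \sum_(a | a != i) b a * logder theta (z - x a).
  have Th : holomorphic_at T (x i).
    apply: holomorphic_sum => a ai; apply: holomorphicM; first exact: holomorphic_cst.
    apply: holomorphic_shift; apply: (logder_holomorphic theta_L) => /x_distinct ia.
    by rewrite ia eqxx in ai.
  have gs : holomorphic_at (fun z => g (z - x i)) (x i).
    by apply: holomorphic_shift; rewrite subrr; exact: gh.
  exists (fun z => b i * g (z - x i) + (z + - x i) * T z); split.
  + apply: holomorphicD.
      by apply: (holomorphicM _ gs); exact: holomorphic_cst.
    apply: (holomorphicM _ Th).
    by apply: holomorphicD; [exact: holomorphic_id|exact: holomorphic_cst].
  + have /nbhs_modulusP[d d0 Hd] := near_pole i.
    apply/nbhs_modulusP; exists d => // z /Hd zp zi.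
    rewrite /f; case: pselect => [pz|npz]; first by case: (zp zi pz).
    have zi0 : z - x i != 0 by rewrite subr_eq0.
    by rewrite /S (bigD1 i) //= gE // mulrDl mulrA -/(T z) [(z - _) * _]mulrC mulfK.
  + by rewrite mxE /= !subrr g0 mulr1 mul0r addr0.
  + rewrite mxE /=.
    have dgs : has_derivative (fun z => g (z - x i)) (x i) zeta_const.
      rewrite -dg -[derive1 g 0]mulr1.
      rewrite (_ : (fun z => _) = fun z => g (1 * z - x i)); last first.
        by apply/funext => z; rewrite mul1r.
      apply: has_derivative_comp; first exact: has_derivative_affine.
      rewrite mul1r subrr; exact: (holomorphic_derivative gh).
    have daff : has_derivative (fun z => z + - x i) (x i) 1.
      rewrite (_ : (fun z => _) = fun z => 1 * z - x i); first exact: has_derivative_affine.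
      by apply/funext => z; rewrite mul1r.
    have := has_derivativeD (has_derivativeM (has_derivative_cst (b i) (x i)) dgs)
       (has_derivativeM daff (holomorphic_derivative Th)).
    move=> /has_derivative_derive1 ->.
    rewrite subrr mul0r add0r mul0r addr0 mul1r (bigD1 i) //= {1}/zeta_matrix eqxx.
    congr (_ + _); first by rewrite mulrC.
    by apply: eq_bigr => a ai; rewrite /zeta_matrix (negbTE ai) mulrC.
Qed.

Lemma F_D_spec b : \sum_i b i = 0 ->
  exists c : C, forall i, F_D L x b i 0 = b i /\
    F_D L x b i 1 = \sum_a zeta_matrix i a * b a + c.
Proof.
move=> b0; have E := restr_2D_exists b0.
have [] : restr_2D L x (F_D L x b) /\ forall i, F_D L x b i 0 = b i.
  rewrite /F_D; case: xgetP => [F _ //|].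
  by move=> /(_ _)/(_ (conj E _))[] => i; rewrite mxE.
move=> FE F0; have [|c cE] := restr_2D_uniq FE E; first by move=> i; rewrite F0 mxE.
by exists c => i; rewrite F0 cE mxE.
Qed.

End PrincipalParts.

(** * The bracket in logarithmic coordinates *)

Lemma dfwith_id (I : eqType) (T : I -> Type) (f : forall i, T i) i : dfwith f i (f i) = f.
Proof. by apply: functional_extensionality_dep => j; case: dfwithP. Qed.

Section LogDerivatives.
Variable R : realType.
Local Notation C := (CC R).
Implicit Types (f g : C -> C) (z c : C).

(** For products of theta functions, logarithmic derivatives add up. *)
Definition has_logder f z c : Prop := f z != 0 /\ has_derivative f z (c * f z).

Lemma has_logder_cst (u z : C) : u != 0 -> has_logder (fun=> u) z 0.
Proof. by split; rewrite ?mul0r; [|exact: has_derivative_cst]. Qed.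

Lemma has_logderM f g z c d : has_logder f z c -> has_logder g z d ->
  has_logder (fun w => f w * g w) z (c + d).
Proof.
move=> [f0 df] [g0 dg]; split; first exact: mulf_neq0.
have -> : (c + d) * (f z * g z) = c * f z * g z + f z * (d * g z) by ring.
exact: has_derivativeM.
Qed.

Lemma has_logderV f z c : has_logder f z c -> has_logder (fun w => (f w)^-1) z (- c).
Proof.
move=> [f0 df]; split; first by rewrite invr_neq0.
have -> : - c / f z = - (c * f z) / f z ^+ 2 by field.
exact: has_derivativeV.
Qed.

Lemma has_logder_prod (I : Type) (s : seq I) (P : pred I) (F : I -> C -> C) z (c : I -> C) :
  (forall i, P i -> has_logder (F i) z (c i)) ->
  has_logder (fun w => \prod_(i <- s | P i) F i w) z (\sum_(i <- s | P i) c i).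
Proof.
move=> H; elim: s => [|i s IH].
  rewrite big_nil (_ : (fun w => _) = fun=> 1).
    exact: (has_logder_cst z (oner_neq0 _)).
  by apply/funext => w; rewrite big_nil.
rewrite big_cons; have [Pi|nPi] := boolP (P i); last first.
  rewrite (_ : (fun w => _) = fun w => \prod_(j <- s | P j) F j w) //.
  by apply/funext => w; rewrite big_cons (negbTE nPi).
rewrite (_ : (fun w => _) = fun w => F i w * \prod_(j <- s | P j) F j w).
  exact: (has_logderM (H i Pi) IH).
by apply/funext => w; rewrite big_cons Pi.
Qed.

Lemma has_logder_derive1 f z c : has_logder f z c -> derive1 f z = c * f z.
Proof. by move=> [_ /has_derivative_derive1]. Qed.

Lemma has_logder_comp_affine f (u v z c : C) : has_logder f (u * z + v) c ->
  has_logder (fun w => f (u * w + v)) z (c * u).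
Proof.
move=> [f0 df]; split => //.
rewrite mulrAC; apply: has_derivative_comp; first exact: has_derivative_affine.
exact: df.
Qed.

Lemma has_logder_id (z : C) : z != 0 -> has_logder (fun w => w) z z^-1.
Proof.
move=> z0; split => //; rewrite mulVf //.
rewrite (_ : (fun w => _) = fun w => 1 * w + 0); first exact: has_derivative_affine.
by apply/funext => w; rewrite mul1r addr0.
Qed.

End LogDerivatives.

Section Bracket.
Variable R : realType.
Local Notation C := (CC R).
Variables (L : set C) (theta : C -> C).
Hypotheses (L_lattice : is_lattice L) (theta_L : is_theta L theta).
Variables (m : nat) (s0 : C -> C) (x y : 'I_m -> C).
Hypotheses (x_distinct : distinct_mod L x) (y_neq0 : forall i, y i != 0).
Hypothesis s0_neq0 : forall i, s0 (x i) != 0.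
Implicit Types (a b : 'I_m -> C).

Local Notation W := (zeta_matrix theta x).

(** The covector sum_i a_i dx_i + b_i dy_i / y_i; it is an element of
    rho^-1 (H_D) when the b_i sum to 0. *)
Definition covector a b : 'M[C]_(m, 2) :=
  \sum_i a i *: dx s0 x y i + \sum_i (b i / y i) *: dy s0 x i.

Lemma covector0 a b i : covector a b i 0 = b i / y i * s0 (x i).
Proof.
rewrite /covector /dx /dy mxE !summxE big1 => [|j _]; last first.
  by rewrite !mxE andbF !mulr0.
rewrite add0r (bigD1 i) //= big1 => [|j ji]; rewrite !mxE ?eqxx /=.
  by rewrite mulr0 mulr1 !addr0.
by rewrite [i == j]eq_sym (negbTE ji) /= !mulr0 addr0 mulr0.
Qed.

Lemma covector1 a b i : covector a b i 1 =
  a i * (phi_of s0 x y i)^-1 + b i / y i * derive1 s0 (x i).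
Proof.
rewrite /covector /dx /dy mxE !summxE (bigD1 i) //= big1 => [|j ji]; rewrite !mxE ?eqxx /=.
  rewrite addr0 mulr1; congr (_ + _).
  rewrite (bigD1 i) //= big1 => [|j ji]; rewrite !mxE ?eqxx /=.
    by rewrite mulr0 mulr1 addr0 add0r.
  by rewrite [i == j]eq_sym (negbTE ji) /= !mulr0 addr0 mulr0.
by rewrite [i == j]eq_sym (negbTE ji) /= !mulr0.
Qed.

Definition zeta_sum b l : C := \sum_k W l k * b k.

(** The terms with derive1 s0 are symmetric under exchange of the two covectors,
    so they cancel; the additive constants in F_D are multiplied by the sum of
    the weights of the other covector, which is 0. *)
Lemma cotangent_bracketE a b a' b' : \sum_i b i = 0 -> \sum_i b' i = 0 ->
  cotangent_bracket L x (phi_of s0 x y) (covector a b) (covector a' b') =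
  \sum_l (b' l * a l - b l * a' l + (zeta_sum b' l * b l - zeta_sum b l * b' l)).
Proof.
move=> b0 b'0.
have rhoE c d : rho (phi_of s0 x y) (covector c d) = d.
  apply/funext => i; rewrite /rho covector0 /phi_of.
  by rewrite -mulrA [s0 _ * _]mulrC divfK // divfK.
rewrite /cotangent_bracket !rhoE /tau.
have [k kE] := F_D_spec L_lattice theta_L x_distinct b0.
have [k' kE'] := F_D_spec L_lattice theta_L x_distinct b'0.
set F := F_D L x _ in kE *; set F' := F_D L x _ in kE' *.
transitivity (\sum_l (b' l * a l - b l * a' l +
    (zeta_sum b' l * b l - zeta_sum b l * b' l) + (k' * b l - k * b' l))).
  apply: eq_bigr => l _.
  move: (covector0 a b l) (covector1 a b l) (covector0 a' b' l) (covector1 a' b' l).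
  move: (covector a b) (covector a' b') => u u' u0 u1 u'0 u'1.
  rewrite !mxE /= u0 u1 u'0 u'1.
  have [-> ->] := kE l; have [-> ->] := kE' l.
  rewrite -/(zeta_sum _ _) -/(zeta_sum _ _) /phi_of.
  have y0 := y_neq0 l; have s00 := s0_neq0 l.
  by field; rewrite y0 s00.
rewrite big_split /= [X in _ + X = _]sumrB -!big_distrr /= b0 b'0 !mulr0.
by rewrite subrr addr0.
Qed.

Lemma theta_diff_neq0 (i j : 'I_m) : i != j -> theta (x i - x j) != 0.
Proof.
by move=> ij; apply/(theta_neq0 theta_L) => /x_distinct /eqP; apply/negP.
Qed.

Lemma theta_logder z : theta z != 0 -> has_logder theta z (logder theta z).
Proof.
move=> z0; split => //; rewrite /logder divfK //.
exact: (holomorphic_derivative (theta_holomorphic theta_L z)).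
Qed.

(** The factor theta (x_k - x_i) contributes W k i to the derivative along x_k
    and - W k i to the one along x_i.  The term k = i, which is missing from the
    product, would contribute W i i - W i i = 0, so it may be added. *)
Lemma y'_logder_x i l : has_logder (fun t => y' theta i (dfwith x l t) y) (x l)
  (W l i - (l == i)%:R * \sum_k W k i).
Proof.
have -> : W l i - (l == i)%:R * \sum_k W k i =
    0 + \sum_(k | k != i) ((l == k)%:R - (l == i)%:R) * W k i.
  transitivity (\sum_k ((l == k)%:R - (l == i)%:R) * W k i); last first.
    by rewrite (bigD1 i) //= subrr mul0r.
  under [RHS]eq_bigr do rewrite mulrBl.
  rewrite sumrB -big_distrr /=; congr (_ - _).
  rewrite (bigD1 l) //= eqxx mul1r big1 ?addr0 // => k kl.
  by rewrite eq_sym (negbTE kl) mul0r.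
apply: has_logderM; first exact: has_logder_cst.
apply: has_logder_prod => k ki.
have -> : W k i = logder theta (x k - x i) by rewrite /zeta_matrix eq_sym (negbTE ki).
have xki := theta_logder (theta_diff_neq0 ki).
have [lk|lk] := eqVneq l k.
  have li : l != i by rewrite lk.
  rewrite lk in li *; rewrite (negbTE li) subr0 mulrC.
  rewrite (_ : (fun t => _) = fun t => theta (1 * t - x i)).
    by apply: has_logder_comp_affine; rewrite mul1r.
  by apply/funext => t; rewrite dfwithin dfwithout // mul1r.
have [li|li] := eqVneq l i.
  rewrite li in lk *; rewrite sub0r mulrC.
  rewrite (_ : (fun t => _) = fun t => theta ((-1) * t + x k)).
    by apply: has_logder_comp_affine; rewrite mulN1r addrC.
  by apply/funext => t; rewrite dfwithin dfwithout // mulN1r addrC.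
rewrite subr0 mul0r (_ : (fun t => _) = fun=> theta (x k - x i)).
  by apply: has_logder_cst; exact: theta_diff_neq0.
by apply/funext => t; rewrite !dfwithout.
Qed.

Lemma y'_logder_y i l : has_logder (fun t => y' theta i x (dfwith y l t)) (y l)
  ((l == i)%:R / y l).
Proof.
rewrite /y' -[_ / _]addr0; apply: has_logderM; last first.
  by apply: has_logder_cst; apply/prodf_neq0 => j ji; exact: theta_diff_neq0.
have [->|li] := eqVneq l i.
  rewrite mul1r (_ : (fun t => _) = fun t => t); first exact: has_logder_id.
  by apply/funext => t; rewrite dfwithin.
rewrite mul0r (_ : (fun t => _) = fun=> y i); first exact: has_logder_cst.
by apply/funext => t; rewrite dfwithout.
Qed.

Lemma differential_y'_ratio i j :
  let b k := y'_ratio theta j i x y * ((k == j)%:R - (k == i)%:R) in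
  differential s0 (y'_ratio theta j i) x y =
  covector (fun l => zeta_sum b l - (\sum_k W k l) * b l) b.
Proof.
move=> b; rewrite /differential /covector.
congr (_ + _); apply: eq_bigr => l _; congr (_ *: _).
  have := has_logderM (y'_logder_x j l) (has_logderV (y'_logder_x i l)).
  move=> /has_logder_derive1; rewrite dfwith_id -/(y'_ratio theta j i x y) => H.
  rewrite [LHS]H; set Y := y'_ratio theta j i x y in b *.
  have at_l k : (l == k)%:R * \sum_n W n k = (l == k)%:R * \sum_n W n l.
    by have [->|_] := eqVneq l k; rewrite ?mul0r.
  have -> : zeta_sum b l = Y * (W l j - W l i).
    rewrite /zeta_sum /b; under eq_bigr do rewrite mulrCA mulrBr.
    rewrite -big_distrr sumrB /=; congr (_ * (_ - _)).
      rewrite (bigD1 j) //= eqxx mulr1 big1 ?addr0 // => k kj.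
      by rewrite (negbTE kj) mulr0.
    rewrite (bigD1 i) //= eqxx mulr1 big1 ?addr0 // => k ki.
    by rewrite (negbTE ki) mulr0.
  by rewrite !at_l /b; ring.
have := has_logderM (y'_logder_y j l) (has_logderV (y'_logder_y i l)).
move=> /has_logder_derive1; rewrite dfwith_id -/(y'_ratio theta j i x y) => H.
by rewrite [LHS]H /b; ring.
Qed.

Lemma differential_x_coord k :
  differential s0 (@x_coord R m k) x y = covector (fun l => (l == k)%:R) (fun=> 0).
Proof.
rewrite /differential /covector; congr (_ + _); apply: eq_bigr => l _; congr (_ *: _).
  apply: has_derivative_derive1; have [->|lk] := eqVneq l k.
    rewrite /x_coord (_ : (fun t => _) = fun t => 1 * t + 0).
      exact: has_derivative_affine.
    by apply/funext => t; rewrite dfwithin mul1r addr0.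
  rewrite /x_coord (_ : (fun t => _) = fun=> x k); first exact: has_derivative_cst.
  by apply/funext => t; rewrite dfwithout.
by rewrite mul0r; exact/has_derivative_derive1/has_derivative_cst.
Qed.

Lemma sum_ratio_weights (Y : C) (i j : 'I_m) :
  \sum_k Y * ((k == j)%:R - (k == i)%:R) = 0.
Proof.
rewrite -big_distrr sumrB /=.
rewrite (bigD1 j) //= eqxx big1 => [|k kj]; last by rewrite (negbTE kj).
rewrite (bigD1 i) //= eqxx big1 => [|k ki]; last by rewrite (negbTE ki).
by rewrite !addr0 subrr mulr0.
Qed.

End Bracket.


Unset Implicit Arguments.

Theorem proposition7p2 (R : realType) (L : set (CC R)) (L_lattice : is_lattice L)
  (e : CC R -> CC R -> CC R) (e_aut : is_automorphy L e)
  (n : nat) (n_gt1 : (1 < n)%N) (e_deg : has_degree L e n%:Z)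
  (m : nat) (m_ge1 : (1 <= m)%N)
  (theta : CC R -> CC R) (theta_L : is_theta L theta)
  (U0 : set (CC R)) (U0_open : stable_open L U0)
  (s0 : CC R -> CC R) (s0_sect : nonvanishing_section L e U0 s0)
  (x y : 'I_m -> CC R) (xy_chart : in_chart L U0 x y) :
  [/\ forall i j : 'I_m,
        poisson_bracket L s0 (x_coord i) (x_coord j) x y = 0,
      forall i j k : 'I_m,
        poisson_bracket L s0 (y'_ratio theta j i) (y'_ratio theta k i) x y = 0
    & forall i j k : 'I_m,
        poisson_bracket L s0 (y'_ratio theta j i) (@x_coord R m k) x y =
        ((j == k)%:R - (i == k)%:R) * y'_ratio theta j i x y].
Proof.
have [xU x_distinct y_neq0] := xy_chart; have [_ _ s0U] := s0_sect.
have s0_neq0 i : s0 (x i) != 0 by apply: s0U.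
have sum0 : \sum_(i < m) (0 : CC R) = 0 by rewrite big1.
have zeta_sum0 l : zeta_sum theta x (fun=> 0) l = 0.
  by rewrite /zeta_sum big1 // => k _; rewrite mulr0.
have diff_ratio i j := differential_y'_ratio theta_L s0 x_distinct y_neq0 i j.
have bracketE := cotangent_bracketE L_lattice theta_L x_distinct y_neq0 s0_neq0.
split=> [i j|i j k|i j k]; rewrite /poisson_bracket.
- rewrite !differential_x_coord bracketE // big1 // => l _.
  by rewrite !mul0r !mulr0 !subrr addr0.
- rewrite !diff_ratio bracketE ?sum_ratio_weights // big1 // => l _.
  by ring.
- rewrite diff_ratio differential_x_coord bracketE ?sum_ratio_weights //.
  rewrite (bigD1 k) //= [X in _ + X = _]big1 => [|l lk]; last first.
    by rewrite zeta_sum0 (negbTE lk) /=; ring.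
  by rewrite zeta_sum0 eqxx [k == j]eq_sym [k == i]eq_sym /=; ring.
Qed.
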